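(* Minimum Sum Coloring with Bundles restricted to instances in which $G$ is a tree and $\mathcal{B}$ is a partition of $V$ can be solved in $O((2\ell)^t\, n\,\ell^2)$ time, where $n=|V|$, $\ell=|\mathcal{B}|$ is the number of bundles, and $t$ is the number of non-singleton bundles (bundles $B$ with $|B|\ge2$).
   Context: Minimum Sum Coloring with Bundles: given an undirected graph $G=(V,E)$, a family $\mathcal{B}=\{B_1,\dots,B_\ell\}$ of non-empty subsets of $V$ (bundles) such that every vertex lies in at least one bundle, a weight function $w\colon\mathcal{B}\to\mathbb{Z}_{>0}$ and a positive integer $C$, decide whether there exists a proper coloring $c\colon V\to\mathbb{Z}_{>0}$ (i.e. $c(u)\ne c(v)$ for every edge $uv$) with $\mathrm{cost}(c)=\sum_{j=1}^{\ell} w(B_j)\max\{c(v)\mid v\in B_j\}\le C$ (the algorithm computes the minimum cost). *)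

(* Defs.v *)
From mathcomp Require Import all_boot.

Set Implicit Arguments.
Unset Strict Implicit.
Unset Printing Implicit Defensive.

(** * The problem *)

Definition simple_graph (V : finType) (e : rel V) : Prop :=
  symmetric e /\ irreflexive e.

(* [ucycle e p]: p is a cyclic e-walk without repeated vertices.  For a
   simple graph, those of size at most 2 are the empty sequence and single edges
   traversed back and forth. *)
Definition acyclic (V : finType) (e : rel V) : Prop :=
  forall p : seq V, ucycle e p -> size p <= 2.

Definition is_tree (V : finType) (e : rel V) : Prop :=
  [/\ simple_graph e, 0 < #|V|, (forall x y : V, connect e x y) & acyclic e].

Record instance := Instance {
  num_vertices : nat;
  edge : rel 'I_num_vertices;
  bundles : {set {set 'I_num_vertices}};
  weight : {set 'I_num_vertices} -> nat;  (* only its values on [bundles] matter *)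
  budget : nat
}.

Arguments edge : clear implicits.
Arguments weight : clear implicits.

Definition valid_instance (I : instance) : Prop :=
  [/\ simple_graph (edge I),
      set0 \notin bundles I,
      cover (bundles I) = [set: 'I_(num_vertices I)],
      (forall b, b \in bundles I -> 0 < weight I b)
    & 0 < budget I].

Definition num_bundles (I : instance) : nat := #|bundles I|.

Definition num_nonsingleton (I : instance) : nat :=
  #|[set b in bundles I | 2 <= #|b| ]|.

Definition proper_coloring (I : instance) (c : 'I_(num_vertices I) -> nat) : Prop :=
  (forall v, 0 < c v) /\ (forall u v, edge I u v -> c u <> c v).

Arguments proper_coloring : clear implicits.

Definition cost (I : instance) (c : 'I_(num_vertices I) -> nat) : nat :=
  \sum_(b in bundles I) weight I b * \max_(v in b) c v.

Arguments cost : clear implicits.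

Definition yes_instance (I : instance) : Prop :=
  exists c : 'I_(num_vertices I) -> nat, proper_coloring I c /\ cost I c <= budget I.

Definition is_min_cost (I : instance) (m : nat) : Prop :=
  (exists c : 'I_(num_vertices I) -> nat, proper_coloring I c /\ cost I c = m) /\
  (forall c : 'I_(num_vertices I) -> nat, proper_coloring I c -> m <= cost I c).

(** * Instances as input words *)

(* E lists every undirected edge once, in one of its two orientations. *)
Definition lists_edges (n : nat) (e : rel 'I_n) (E : seq ('I_n * 'I_n)) : Prop :=
  [/\ uniq E,
      (forall u v, (u, v) \in E -> (v, u) \notin E)
    & (forall u v, e u v = ((u, v) \in E) || ((v, u) \in E))].

(* Bs lists every bundle once, each as a list of its vertices without repetition. *)
Definition lists_bundles (n : nat) (B : {set {set 'I_n}}) (Bs : seq (seq 'I_n)) : Prop :=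
  all uniq Bs /\ perm_eq [seq [set x in b] | b <- Bs] (enum B).

(* The input word is
     n, number of bundles, C, number of edges,
   followed by the two endpoints of each edge, followed, for each bundle, by its
   weight, its size and its vertices; vertices are numbered from 0.
   Edges, bundles, and vertices within a bundle may come in any order. *)
Definition encodes (I : instance) (s : seq nat) : Prop :=
  exists (E : seq ('I_(num_vertices I) * 'I_(num_vertices I)))
         (Bs : seq (seq 'I_(num_vertices I))),
    [/\ lists_edges (edge I) E,
        lists_bundles (bundles I) Bs
      & s = [:: num_vertices I; size Bs; budget I; size E]
            ++ flatten [seq [:: val p.1; val p.2] | p <- E]
            ++ flatten [seq weight I [set x in b] :: size b :: map val b | b <- Bs]].

(** * Machine model: structured random-access programs under the uniform cost
    criterion *)

(* The memory consists of arrays of natural numbers, [m a i] being cell i of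
   array a.  Array names are literals, so a program uses only finitely many
   arrays (interleaving them in one memory costs a constant factor), whereas
   cell indices are computed at run time (indirect addressing).  The arithmetic
   is addition and truncated subtraction only: with unit-cost multiplication,
   numbers could become exponentially long in the running time. *)
Definition memory := nat -> nat -> nat.

Definition update (m : memory) (a i x : nat) : memory :=
  fun a' i' => if (a' == a) && (i' == i) then x else m a' i'.

Inductive expr :=
| Cst of nat
| Get of nat & expr
| Add of expr & expr
| Sub of expr & expr.

Inductive cmd :=
| Skip
| Put of nat & expr & expr  (* Put a i x stores x in cell i of array a *)
| Seq of cmd & cmd
| If of expr & cmd & cmd    (* in tests, nonzero means true *)
| While of expr & cmd.

Fixpoint eval (m : memory) (x : expr) : nat :=
  match x with
  | Cst k => k
  | Get a i => m a (eval m i)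
  | Add x1 x2 => eval m x1 + eval m x2
  | Sub x1 x2 => eval m x1 - eval m x2
  end.

Fixpoint expr_time (x : expr) : nat :=
  match x with
  | Cst _ => 1
  | Get _ i => (expr_time i).+1
  | Add x1 x2 | Sub x1 x2 => (expr_time x1 + expr_time x2).+1
  end.

(* [exec p m k m']: started in memory m, p halts after k steps in memory m'. *)
Inductive exec : cmd -> memory -> nat -> memory -> Prop :=
| ExecSkip m : exec Skip m 1 m
| ExecPut m a i x :
    exec (Put a i x) m (expr_time i + expr_time x).+1
         (update m a (eval m i) (eval m x))
| ExecSeq p q m k m' k' m'' :
    exec p m k m' -> exec q m' k' m'' -> exec (Seq p q) m (k + k') m''
| ExecIfTrue x p q m k m' :
    eval m x != 0 -> exec p m k m' -> exec (If x p q) m (expr_time x + k).+1 m'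
| ExecIfFalse x p q m k m' :
    eval m x = 0 -> exec q m k m' -> exec (If x p q) m (expr_time x + k).+1 m'
| ExecWhileTrue x p m k m' k' m'' :
    eval m x != 0 -> exec p m k m' -> exec (While x p) m' k' m'' ->
    exec (While x p) m (expr_time x + k + k').+1 m''
| ExecWhileFalse x p m :
    eval m x = 0 -> exec (While x p) m (expr_time x).+1 m.

Definition input_array := 0.
Definition output_array := 1.

Definition initial_memory (s : seq nat) : memory :=
  fun a i => if a == input_array then nth 0 s i else 0.

(* Cell 0 of the output array must receive the minimum cost, and cell 1 the
   answer to the decision problem (nonzero for yes). *)
Definition solves_within (p : cmd) (I : instance) (T : nat) : Prop :=
  forall s : seq nat, encodes I s ->
  exists (k : nat) (m : memory),
    [/\ exec p (initial_memory s) k m,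
        k <= T,
        is_min_cost I (m output_array 0)
      & (m output_array 1 != 0) <-> yes_instance I].

(* Main.v *)
Require Import Defs.
From mathcomp Require Import all_boot zify.

Set Implicit Arguments.
Unset Strict Implicit.
Unset Printing Implicit Defensive.

(* Some optimal colouring uses only the colours 1..2l: if a bundle maximum
   exceeds 2l, then one of the l pairs {2i+1, 2i+2} contains none of the l bundle
   maxima, and recolouring all colours above 2i with this pair, along the
   bipartition of the tree, increases no bundle maximum.

   The algorithm guesses a cap x_B in 1..2l for the maximum of every non-singleton
   bundle B, and sets x_B = 0 for singletons.  Instead of forbidding colours above
   the cap, it charges w(B) (c(v) - x_B) for each vertex v of B whose colour
   exceeds x_B.  The sum of w(B) x_B and of these penalties is never below the
   cost of c, and equals it when the caps are the bundle maxima.  For fixed caps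
   the penalties are minimised by dynamic programming on the tree, from the
   leaves to the root. *)

(** * Trees *)

(** The maximum of a bundle couples vertices that may lie anywhere in the tree. Once the caps are
    fixed, the objective is a constant plus a sum over single vertices, so a table indexed by a
    vertex and its colour suffices. Charging for an excess instead of forbidding it keeps every
    entry finite even when no proper colouring respects the caps, and lets a singleton bundle enter
    with the single cap 0, its penalty being its whole cost. Hence there are [L ^ t] guesses for
    [L = 2l], and merging a vertex into its parent compares [L * L] pairs of colours, which gives
    the factor [n * l ^ 2] per guess. The machine shapes the rest. Without multiplication, products
    and row addresses are accumulated by addition. No adjacency lists are built: the degree and the
    sum of the neighbours of each vertex suffice, because for a leaf this sum is its only
    neighbour. *)

Section Tree.
Variables (V : finType) (e : rel V).

(** Acyclicity enters the rest only through the second clause: there are no edges besides the parent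
    edges. Depths give the bipartition and rule out cycles of [par]. *)
Definition rooted (r : V) (par : V -> V) (dep : V -> nat) : Prop :=
  (forall v, v != r -> e v (par v) /\ dep v = (dep (par v)).+1) /\
  (forall u v, e u v -> (u != r /\ v = par u) \/ (v != r /\ u = par v)).

Let restr (S : {set V}) : rel V := [rel x y | [&& e x y, x \in S & y \in S]].

Let rooted_on (r : V) (S : {set V}) (par : V -> V) (dep : V -> nat) : Prop :=
  [/\ r \in S,
      {in S &, forall x y, connect (restr S) x y},
      {in S, forall v, v != r ->
         [/\ par v \in S, e v (par v) & dep v = (dep (par v)).+1]}
    & {in S &, forall u v, e u v ->
         (u != r /\ v = par u) \/ (v != r /\ u = par v)}].

(* Two neighbours of [x] in a connected set avoiding [x] would close a cycle. *)
Lemma unique_attachment (S : {set V}) (x u u' : V) :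
  acyclic e -> symmetric e -> {in S &, forall x y, connect (restr S) x y} ->
  x \notin S -> u \in S -> u' \in S -> e x u -> e x u' -> u' = u.
Proof.
move=> acy sym conS xS uS u'S exu exu'; apply/eqP/negPn/negP => neq.
have /connectP[p0 pth0 last0] := conS u u' uS u'S.
case: (shortenP pth0) last0 => p pth unip _ lastp.
have pS : {subset u :: p <= S}.
  move=> z; rewrite inE => /orP[/eqP->//|zp].
  have : all (mem S) p.
    elim: p {unip lastp zp} u pth {uS exu neq pth0} => //= y p IH u /andP[/and3P[_ _ yS] pth].
    by rewrite yS (IH y).
  by move/allP/(_ _ zp).
have pe : path e u p by apply: sub_path pth => a b /and3P[].
have cyc : ucycle e (x :: u :: p).
  rewrite /ucycle; apply/andP; split; last first.
    by rewrite cons_uniq unip andbT; apply/negP => /pS; rewrite (negPf xS).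
  by rewrite (cycle_path x) /= -lastp sym exu' exu.
case: p lastp neq cyc {pth unip pS pe} => [/= -> |y p _ _ /acy //].
by rewrite eqxx.
Qed.

(** A connected set containing [r] grows by one vertex at a time: connectivity supplies an edge
    leaving it, and by [unique_attachment] the new vertex has a single neighbour inside, which
    becomes its parent. *)
Lemma tree_rooted (r : V) : is_tree e -> exists par dep, rooted r par dep.
Proof.
move=> [[sym irr] _ con acy].
suff grow k : k < #|V| -> exists (S : {set V}) par dep, #|S| = k.+1 /\ rooted_on r S par dep.
  have Vpos : 0 < #|V| by apply/card_gt0P; exists r.
  have [|S [par [dep [cS [rS _ Hp He]]]]] := grow #|V|.-1; first by rewrite prednK.
  have ST x : x \in S.
    suff -> : S = setT by rewrite inE.
    by apply/eqP; rewrite eqEcard subsetT cardsT cS prednK /=.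
  exists par, dep; split=> [v vr|u v euv]; last exact: He.
  by have [] := Hp v (ST v) vr.
elim: k => [|k IH] kV.
  exists [set r], id, (fun _ => 0); rewrite cards1; split=> //; split.
  - by rewrite inE.
  - by move=> x y /set1P-> /set1P->.
  - by move=> v /set1P-> /eqP.
  - by move=> u v /set1P-> /set1P->; rewrite irr.
have [|S [par [dep [cS [rS conS Hp He]]]]] := IH; first by lia.
have [z zS] : exists z, z \notin S.
  apply/existsP; rewrite -negb_forall; apply/negP => /forallP allS.
  suff E : #|S| = #|V| by lia.
  by apply: eq_card => x; rewrite allS.
have [[u x] /= /and3P[uS xS eux]] :
    exists p : V * V, [&& p.1 \in S, p.2 \notin S & e p.1 p.2].
  apply/existsP; rewrite -[X in is_true X]negbK; apply/negP => /existsPn none.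
  (* If no edge left [S], it would be a union of components and contain [z]. *)
  have clS : closed e S.
    apply: intro_closed => [a b|a b eab aS].
      by apply/idP/idP => _; exact: con.
    by have /= := none (a, b); rewrite aS eab andbT negbK.
  by have := closed_connect clS (con r z); rewrite rS (negPf zS).
have uniqx v : v \in S -> e x v -> v = u.
  move=> vS exv; apply: (unique_attachment acy sym conS xS uS vS _ exv).
  by rewrite sym.
have xr : x != r by apply: contraNneq xS => ->.
have neqx v : v \in S -> (v == x) = false.
  by move=> vS; apply/negbTE; apply: contraNneq xS => <-.
exists (x |: S), (fun v => if v == x then u else par v),
       (fun v => if v == x then (dep u).+1 else dep v).
split; first by rewrite cardsU1 xS cS.
have mono a b : connect (restr S) a b -> connect (restr (x |: S)) a b.
  apply: connect_sub => c d /and3P[ecd cS' dS]; apply: connect1.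
  by rewrite /restr /= ecd !inE cS' dS !orbT.
have ux : connect (restr (x |: S)) u x.
  by apply: connect1; rewrite /restr /= eux !inE uS eqxx orbT.
have xu : connect (restr (x |: S)) x u.
  by apply: connect1; rewrite /restr /= sym eux !inE uS eqxx orbT.
split.
- by rewrite !inE rS orbT.
- move=> a b /setU1P[->|aS] /setU1P[->|bS] //.
  + exact: connect_trans xu (mono _ _ (conS _ _ uS bS)).
  + exact: connect_trans (mono _ _ (conS _ _ aS uS)) ux.
  + exact: mono (conS _ _ aS bS).
- move=> v /setU1P[->|vS] vr.
    by rewrite eqxx neqx // !inE uS orbT sym.
  have [pS ep dp] := Hp v vS vr.
  by rewrite (neqx _ vS) (neqx _ pS) !inE pS orbT.
- move=> a b /setU1P[->|aS] /setU1P[->|bS] eab.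
  + by rewrite irr in eab.
  + by left; rewrite eqxx (uniqx b).
  + by right; rewrite eqxx (uniqx a) // sym.
  + by rewrite (neqx _ aS) (neqx _ bS); apply: He.
Qed.

End Tree.

Section Rooted.
Variables (V : finType) (e : rel V) (r : V) (par : V -> V) (dep : V -> nat).
Hypothesis rt : rooted e r par dep.

(** Adjacent depths differ by one. The parity of the depth is the bipartition along which
    [few_colors] recolours. *)
Lemma rooted_parity u v : e u v -> odd (dep u) != odd (dep v).
Proof.
case: rt => Hp He /He [[ur ->]|[vr ->]].
  by have [_ ->] := Hp u ur; rewrite /=; case: odd.
by have [_ ->] := Hp v vr; rewrite /=; case: odd.
Qed.

(* Every edge is charged to its endpoint farther from the root. *)
Lemma tree_edges (E : seq (V * V)) :
  uniq E -> (forall u v, (u, v) \in E -> (v, u) \notin E) ->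
  (forall u v, (u, v) \in E -> e u v) -> size E <= #|V|.
Proof.
case: rt => Hp He uE aE sE.
pose low (p : V * V) := if (p.1 != r) && (p.2 == par p.1) then p.1 else p.2.
rewrite -(size_map low) cardE; apply: uniq_leq_size; last by move=> x _; rewrite mem_enum.
rewrite map_inj_in_uniq // => -[a b] [c d] abE cdE.
have := He _ _ (sE _ _ abE); have := He _ _ (sE _ _ cdE).
rewrite /low /=.
case: ifP => [/andP[ar /eqP bp]|nab]; case: ifP => [/andP[cr /eqP dp]|ncd].
- by move=> _ _ ac; rewrite bp dp ac.
- move=> [[cr dp]|[dr cp]] _ ac; first by rewrite cr dp eqxx in ncd.
  by move: (aE _ _ abE); rewrite bp cp ac in cdE *; rewrite cdE.
- move=> _ [[ar bp]|[br ap]] bc; first by rewrite ar bp eqxx in nab.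
  by move: (aE _ _ abE); rewrite ap bc -dp cdE.
- move=> [[cr dp]|[dr cp]]; first by rewrite cr dp eqxx in ncd.
  move=> [[ar bp]|[br ap]]; first by rewrite ar bp eqxx in nab.
  by move=> bd; rewrite cp ap bd.
Qed.

End Rooted.

(** * Colours and caps *)

Lemma few_colors (I : instance) (side : 'I_(num_vertices I) -> bool)
    (c : 'I_(num_vertices I) -> nat) :
  cover (bundles I) = [set: 'I_(num_vertices I)] ->
  (forall u v, edge I u v -> side u != side v) ->
  proper_coloring I c ->
  exists c', [/\ proper_coloring I c', forall v, c' v <= 2 * num_bundles I
               & cost I c' <= cost I c].
Proof.
move=> cov bip [cpos cprop].
have [/forallP small|] := boolP [forall v, c v <= 2 * num_bundles I].
  by exists c.
rewrite negb_forall => /existsP[v0]; rewrite -ltnNge => big0.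
have : v0 \in cover (bundles I) by rewrite cov inE.
case/bigcupP => b0 b0B v0b0.
pose top (b : {set 'I_(num_vertices I)}) := \max_(v in b) c v.
have top_ge (b : {set 'I_(num_vertices I)}) v : v \in b -> c v <= top b.
  by move=> vb; apply: leq_bigmax_cond.
(* A positive maximum [k] lies in the pair [{2i+1, 2i+2}] exactly when [k.-1./2 = i]. The bundle
   [b0] is left out because its maximum exceeds [2l] and so hits none of the [l] pairs; the other
   [l - 1] bundles cannot hit them all. *)
pose s := [seq (top b).-1./2 | b <- enum (bundles I :\ b0)].
have [i il is_] : exists2 i, i < num_bundles I & i \notin s.
  have [/allP all_s|/allPn[i]] := boolP (all (mem s) (iota 0 (num_bundles I))).
    have := uniq_leq_size (iota_uniq 0 (num_bundles I)) all_s.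
    rewrite size_iota size_map -cardE /num_bundles.
    by rewrite [#|bundles I|](cardsD1 b0) b0B add1n ltnn.
  by rewrite mem_iota => /= il is_; exists i.
(* A maximum above [2i] jumps over the free pair, so lowering colours into the pair stays below it.
   For [b0] this holds since [2i + 2 <= 2l]. *)
have gap b : b \in bundles I -> 2 * i < top b -> 2 * i + 2 < top b.
  move=> bB lt_i; have [->|nb] := eqVneq b b0.
    by have := top_ge b0 v0 v0b0; lia.
  rewrite ltnNge; apply/negP => le_i; case/negP: is_.
  apply/mapP; exists b; first by rewrite mem_enum !inE nb.
  by move: lt_i le_i; move: (top b) => k; lia.
pose c' v := if c v <= 2 * i then c v else 2 * i + 1 + side v.
exists c'; split.
- split=> [v|u v euv].
    by rewrite /c'; case: ifP => // _; lia.
  have := bip _ _ euv; have := cprop _ _ euv; rewrite /c'.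
  by case: (side u); case: (side v) => //=;
    case: (leqP (c u)) => ?; case: (leqP (c v)) => ? /=; lia.
- by move=> v; rewrite /c'; case: (side v); case: (leqP (c v)) => /=; lia.
- apply: leq_sum => b bB; rewrite leq_mul2l; apply/orP; right.
  apply/bigmax_leqP => v vb; rewrite -/(top b) /c'.
  case: (leqP (c v)) => [_|lt_c]; first exact: top_ge.
  by have := gap b bB (leq_trans lt_c (top_ge b v vb)); case: (side v) => /=; lia.
Qed.

(** * The penalised objective for given caps *)

Section Objective.
Variables (V : finType) (l L : nat) (w : nat -> nat) (bi : V -> nat).
Hypothesis bi_lt : forall v, bi v < l.

Definition bundle_size (j : nat) : nat := #|[pred v | bi v == j]|.

(** The boolean is read as 0 or 1: a non-singleton bundle has the [L] caps [1..L], a singleton only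
    the cap 0. *)
Definition cap_lo (j : nat) : nat := 1 < bundle_size j.
Definition cap_hi (j : nat) : nat := if 1 < bundle_size j then L else 0.

Definition bundle_cost (c : V -> nat) : nat :=
  \sum_(j < l) w j * \max_(v | bi v == j) c v.

(* Here [c] and [a] number the colours from 0. *)
Definition penalty (x : nat -> nat) (v : V) (a : nat) : nat :=
  w (bi v) * (a.+1 - x (bi v)).

Definition objective (x : nat -> nat) (c : V -> nat) : nat :=
  \sum_(j < l) w j * x j + \sum_v penalty x v (c v).

(** Each vertex belongs to the one bundle [bi v], so the penalties regroup by bundle and can be
    compared with the cost bundle by bundle. *)
Lemma objectiveE x c :
  objective x c =
  \sum_(j < l) w j * (x j + \sum_(v | bi v == j) ((c v).+1 - x j)).
Proof.
rewrite /objective (partition_big (fun v => Ordinal (bi_lt v)) predT) //=.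
rewrite -big_split /=; apply: eq_bigr => j _; rewrite mulnDr; congr (_ + _).
rewrite big_distrr /=; apply: eq_big => [v|v]; first by rewrite -val_eqE.
by rewrite /penalty => /eqP <-.
Qed.

(** In a bundle, the cap plus the excess of a single vertex already reaches the colour of that
    vertex, and the other excesses only add to it. *)
Lemma objective_ge x c : bundle_cost (fun v => (c v).+1) <= objective x c.
Proof.
rewrite objectiveE; apply: leq_sum => j _; rewrite leq_mul2l; apply/orP; right.
apply/bigmax_leqP => v vj; rewrite (bigD1 v) //=; lia.
Qed.

(** Caps equal to the maxima annul the penalties of the non-singleton bundles. A singleton bundle
    has cap 0, and the penalty of its only vertex is its whole cost. *)
Lemma objective_attained c :
  (forall j, j < l -> 0 < bundle_size j) -> (forall v, c v < L) ->
  exists x, (forall j, j < l -> cap_lo j <= x j <= cap_hi j) /\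
            objective x c = bundle_cost (fun v => (c v).+1).
Proof.
move=> ne cL.
pose x j := if 1 < bundle_size j then \max_(v | bi v == j) (c v).+1 else 0.
exists x; split=> [j jl|].
  rewrite /x /cap_lo /cap_hi; case: ifP => //= sz.
  have /card_gt0P[v vj] := ne j jl; apply/andP; split.
    by apply: leq_trans (leq_bigmax_cond _ vj).
  by apply/bigmax_leqP.
rewrite objectiveE; apply: eq_bigr => j _; congr (_ * _).
rewrite /x; case: ifP => sz.
  rewrite [X in _ + X]big1 ?addn0 // => v vj; apply/eqP; rewrite subn_eq0.
  exact: (leq_bigmax_cond (F := fun u => (c u).+1) v vj).
have /mem_card1[v Ev] : bundle_size j = 1 by have := ne j (ltn_ord j); lia.
have E u : (bi u == j) = (u == v) by have := Ev u; rewrite !inE.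
by rewrite !(big_pred1 v).
Qed.

End Objective.

Definition is_min_of (P : nat -> Prop) (m : nat) : Prop :=
  P m /\ forall k, P k -> m <= k.

(** * Dynamic programming along an elimination order *)

Section Peeling.
Variables (V : finType) (par : V -> V) (L : nat) (pen : V -> nat -> nat).

(* The proper colourings of the edges cut off outside [S] that extend [d|S]. *)
Definition extends (S : {set V}) (d c : V -> nat) : Prop :=
  [/\ forall v, c v < L, {in S, c =1 d}
    & forall v, v \notin S -> c v != c (par v)].

(* Entry [f v a], for [v] in [S], already includes the penalties of the vertices
   peeled off below [v]; the table never refers to subtrees. *)
Definition dp_table (S : {set V}) (f : V -> nat -> nat) : Prop :=
  forall d, (forall v, d v < L) ->
  is_min_of (fun k => exists2 c, extends S d c & k = \sum_v pen v (c v))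
            (\sum_(v in S) f v (d v)).

Lemma dp_table_init f :
  (forall v a, a < L -> f v a = pen v a) -> dp_table setT f.
Proof.
move=> fE d dL; split.
  exists d; first by split=> [//|v _ //|v]; rewrite inE.
  by apply: eq_big => [v|v _]; rewrite ?inE ?fE.
move=> _ [c [cL cd _] ->]; rewrite (eq_bigl predT) => [|v]; last by rewrite inE.
by apply: leq_sum => v _; rewrite fE // cd ?inE.
Qed.

Lemma dp_table_step S f f' v (mn : nat -> nat) :
  dp_table S f -> v \in S -> par v \in S -> par v != v ->
  (forall a, a < L ->
     is_min_of (fun k => exists b, [/\ b < L, b != a & k = f v b]) (mn a)) ->
  (forall a, a < L -> f' (par v) a = f (par v) a + mn a) ->
  (forall u a, u \in S -> u != par v -> a < L -> f' u a = f u a) ->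
  dp_table (S :\ v) f'.
Proof.
move=> dp vS pS pv mnP f'p f'u d dL.
set p := par v in pS pv f'p f'u.
(* The old table still wants a colour for [v]: [upd b] prescribes [b] there and agrees with [d]
   elsewhere. *)
pose upd b u := if u == v then b else d u.
have updL b : b < L -> forall u, upd b u < L by move=> bL u; rewrite /upd; case: ifP.
have sumE b : b < L ->
    \sum_(u in S) f u (upd b u) + mn (d p) = \sum_(u in S :\ v) f' u (d u) + f v b.
  move=> bL; rewrite (big_setD1 v) //= /upd eqxx.
  have pSv : p \in S :\ v by rewrite !inE pv.
  rewrite (big_setD1 p) //= [in RHS](big_setD1 p) //= f'p // (negPf pv).
  rewrite (_ : \sum_(u in S :\ v :\ p) f' u (d u) =
               \sum_(u in S :\ v :\ p) f u (if u == v then b else d u)); first by lia.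
  apply: eq_bigr => u; rewrite !inE => /and3P[up uv uS].
  by rewrite f'u // (negPf uv).
split.
  have [[b [bL bp mnE]] _] := mnP (d p) (dL p).
  have [[c [cL cd cS] cE] _] := dp (upd b) (updL b bL).
  exists c; last by have := sumE b bL; rewrite cE -mnE; lia.
  split=> // [u|u].
    by rewrite !inE => /andP[uv uS]; rewrite cd // /upd (negPf uv).
  rewrite !inE negb_and negbK => /orP[/eqP->|]; last exact: cS.
  by rewrite -/p (cd _ vS) (cd _ pS) /upd eqxx (negPf pv).
move=> _ [c [cL cd cS] ->].
have cp : c p = d p by apply: cd; rewrite !inE pv.
have le_mn : mn (d p) <= f v (c v).
  apply: (mnP (d p) (dL p)).2; exists (c v); split; rewrite // -cp.
  by apply: cS; rewrite !inE eqxx.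
have ext : extends S (upd (c v)) c.
  split=> // u uS; rewrite /upd; last by apply: cS; rewrite !inE (negPf uS) andbF.
  by case: eqP => [->//|/eqP uv]; rewrite cd // !inE uv.
have := (dp (upd (c v)) (updL _ (cL v))).2 _ (ex_intro2 _ _ c ext erefl).
have := sumE _ (cL v); lia.
Qed.

Lemma dp_table_root r f a : dp_table [set r] f -> a < L ->
  is_min_of (fun k => exists c, [/\ forall v, c v < L, c r = a,
                          forall v, v != r -> c v != c (par v)
                        & k = \sum_v pen v (c v)]) (f r a).
Proof.
move=> dp aL; have := dp (fun _ => a) (fun _ => aL); rewrite big_set1.
move=> [[c [cL cd cr] ->] lb]; split.
  exists c; split=> // [|v vr]; first by rewrite cd ?inE.
  by apply: cr; rewrite inE.
move=> _ [c' [c'L c'r c'p ->]]; apply: lb; exists c' => //.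
split=> // [v|v]; rewrite inE; last exact: c'p.
by move=> /eqP->.
Qed.
End Peeling.

(** * Mixed radix numerals *)

Section MixedRadix.
Variables lo hi : nat -> nat.

Definition radix_prod (k : nat) : nat := \prod_(i < k) ((hi i).+1 - lo i).
(** The position of [x] in the order in which the odometer runs through the box, digit 0 being the
    least significant. It links the loop counter of the search to the guesses already tried. *)
Definition rank (k : nat) (x : nat -> nat) : nat :=
  \sum_(i < k) (x i - lo i) * radix_prod i.
Definition in_box (k : nat) (x : nat -> nat) : Prop :=
  forall j, j < k -> lo j <= x j <= hi j.

Lemma radix_prodS k : radix_prod k.+1 = radix_prod k * ((hi k).+1 - lo k).
Proof. by rewrite /radix_prod big_ord_recr. Qed.

Lemma rankS k x : rank k.+1 x = rank k x + (x k - lo k) * radix_prod k.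
Proof. by rewrite /rank big_ord_recr. Qed.

Lemma eq_rank k x y : (forall i, i < k -> x i = y i) -> rank k x = rank k y.
Proof. by move=> E; apply: eq_bigr => i _; rewrite E. Qed.

Lemma in_boxW k x : in_box k.+1 x -> in_box k x.
Proof. by move=> bx j jk; apply: bx; apply: ltnW. Qed.

Lemma rank_lt k x : in_box k x -> rank k x < radix_prod k.
Proof.
elim: k => [|k IH] bx; first by rewrite /rank /radix_prod !big_ord0.
have := IH (in_boxW bx); have /andP[] := bx k (leqnn _).
rewrite rankS radix_prodS; move: (radix_prod k) (rank k x) => P R; nia.
Qed.

(** By [rank_lt] the lower digits contribute less than [radix_prod k], so division by it recovers
    the top digit. *)
Lemma rank_inj k x y : in_box k x -> in_box k y -> rank k x = rank k y ->
  forall j, j < k -> x j = y j.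
Proof.
elim: k => [//|k IH] bx b_y.
have := rank_lt (in_boxW bx); have := rank_lt (in_boxW b_y).
rewrite !rankS => lty ltx E.
have P0 : 0 < radix_prod k by lia.
have Ek : x k - lo k = y k - lo k.
  have := congr1 (divn^~ (radix_prod k)) E.
  by rewrite !(addnC (rank _ _)) !divnMDl // !divn_small // !addn0.
have Er : rank k x = rank k y by move: E; rewrite Ek => /addIn.
have xk : x k = y k.
  by have := bx k (leqnn _); have := b_y k (leqnn _); lia.
move=> j; rewrite ltnS leq_eqVlt => /orP[/eqP->//|].
exact: (IH (in_boxW bx) (in_boxW b_y) Er).
Qed.
End MixedRadix.

(** * Program logic *)

(* [eqtype] also has a [Sub]. *)
Local Notation Sub := Defs.Sub.

(** Each loop body and both branches of each test are counted once, so the value depends on the text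
    alone; for the solver it goes into the constant of the time bound. *)
Fixpoint ctime (p : cmd) : nat :=
  match p with
  | Skip => 1
  | Put _ i x => (expr_time i + expr_time x).+1
  | Seq p q => ctime p + ctime q
  | If x p q => (expr_time x + ctime p + ctime q).+1
  | While x p => (expr_time x + ctime p).+1
  end.

Fixpoint written (p : cmd) : seq nat :=
  match p with
  | Skip => [::]
  | Put a _ _ => [:: a]
  | Seq p q | If _ p q => written p ++ written q
  | While _ p => written p
  end.

(** A frame condition on whole arrays: as array names are literals, the arrays that a program may
    change are read off its text, and frame side conditions are settled by computation. *)
Definition unchanged (s : seq nat) (m m' : memory) : Prop :=
  forall a, a \notin s -> m' a = m a.

Fixpoint reads (x : expr) : seq nat :=
  match x with
  | Cst _ => [::]
  | Get a i => a :: reads i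
  | Add x y | Sub x y => reads x ++ reads y
  end.

Lemma eval_unchanged s m m' x :
  unchanged s m m' -> ~~ has (mem s) (reads x) -> eval m' x = eval m x.
Proof.
move=> un; elim: x => //= [a i IH|x IHx y IHy|x IHx y IHy]; last 2 first.
- by rewrite has_cat negb_or => /andP[? ?]; rewrite IHx ?IHy.
- by rewrite has_cat negb_or => /andP[? ?]; rewrite IHx ?IHy.
by rewrite negb_or => /andP[ai ?]; rewrite IH ?un.
Qed.

Lemma unchanged_trans s m1 m2 m3 :
  unchanged s m1 m2 -> unchanged s m2 m3 -> unchanged s m1 m3.
Proof. by move=> h1 h2 a ai; rewrite h2 ?h1. Qed.

Lemma unchanged_sub s s' m1 m2 :
  {subset s <= s'} -> unchanged s m1 m2 -> unchanged s' m1 m2.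
Proof. by move=> sub h a ai; apply: h; apply: contra ai; apply: sub. Qed.

(** For a different array the test reduces under the binder, so the equality of functions is an
    eta-conversion and needs no extensionality. *)
Lemma update_unchanged a i x s m : a \in s -> unchanged s m (update m a i x).
Proof.
move=> ai b bi; rewrite /update.
by case: eqP => [ba|//]; move: bi; rewrite ba ai.
Qed.

Lemma exec_unchanged p m k m' : exec p m k m' -> unchanged (written p) m m'.
Proof.
elim=> //= {p m k m'}; try by move=> *.
- by move=> m a i x; apply: update_unchanged; rewrite inE.
- move=> p q m k m' k' m'' _ h1 _ h2 a; rewrite mem_cat negb_or => /andP[? ?].
  by rewrite h2 ?h1.
- by move=> x p q m k m' _ _ h a; rewrite mem_cat negb_or => /andP[? ?]; rewrite h.
- by move=> x p q m k m' _ _ h a; rewrite mem_cat negb_or => /andP[? ?]; rewrite h.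
- by move=> x p m k m' k' m'' _ _ h1 _ h2 a ai; rewrite h2 ?h1.
Qed.

(* The time bound is the size of the program text times [X], which bounds the
   number of times each instruction is executed. *)
Definition runs (X : nat) (p : cmd) (m : memory) (Q : memory -> Prop) : Prop :=
  exists k m', [/\ exec p m k m', k <= ctime p * X & Q m'].

(** The rule of consequence with the frame built in: a specification states only what its program
    computes, and the preservation of all other arrays comes from [unchanged]. *)
Lemma runs_weaken X Y p m (Q Q' : memory -> Prop) :
  runs X p m Q -> X <= Y -> (forall m', unchanged (written p) m m' -> Q m' -> Q' m') ->
  runs Y p m Q'.
Proof.
move=> [k [m' [ex le_k Qm]]] XY QQ; exists k, m'; split=> //.
  by apply: leq_trans le_k _; rewrite leq_mul2l XY orbT.
exact: QQ (exec_unchanged ex) Qm.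
Qed.

Lemma runs_seq X p q m Q :
  runs X p m (runs X q ^~ Q) -> runs X (Seq p q) m Q.
Proof.
move=> [k [m' [ex le_k [k' [m'' [ex' le_k' Qm]]]]]].
exists (k + k'), m''; split=> //; first exact: ExecSeq ex ex'.
by rewrite mulnDl leq_add.
Qed.

Fixpoint loop_free (p : cmd) : bool :=
  match p with
  | Skip | Put _ _ _ => true
  | Seq p q | If _ p q => loop_free p && loop_free q
  | While _ _ => false
  end.

(** The value on [While] is a dummy, excluded by [loop_free] in [runs_loop_free]. *)
Fixpoint sem (p : cmd) (m : memory) : memory :=
  match p with
  | Skip | While _ _ => m
  | Put a i x => update m a (eval m i) (eval m x)
  | Seq p q => sem q (sem p m)
  | If x p q => if eval m x != 0 then sem p m else sem q m
  end.

Lemma runs_loop_free X p m (Q : memory -> Prop) :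
  loop_free p -> 0 < X -> Q (sem p m) -> runs X p m Q.
Proof.
move=> lf X0 Qm.
suff [k [ex le_k]] : exists k, exec p m k (sem p m) /\ k <= ctime p.
  exists k, (sem p m); split=> //.
  by apply: leq_trans le_k _; rewrite leq_pmulr.
elim: p m lf {Qm} => //= [m _|a i x m _|p IHp q IHq m /andP[lp lq]|x p IHp q IHq m /andP[lp lq]].
- by exists 1; split=> //; constructor.
- by eexists; split; [constructor|].
- have [k [ex le_k]] := IHp m lp; have [k' [ex' le_k']] := IHq (sem p m) lq.
  by exists (k + k'); split; [apply: ExecSeq ex ex'|rewrite leq_add].
- case: (eqVneq (eval m x) 0) => ex /=.
    have [k [exq le_k]] := IHq m lq.
    by exists (expr_time x + k).+1; split; [apply: ExecIfFalse|lia].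
  have [k [exp le_k]] := IHp m lp.
  by exists (expr_time x + k).+1; split; [apply: ExecIfTrue|lia].
Qed.

Definition Var (a : nat) : expr := Get a (Cst 0).
Definition Let (a : nat) (x : expr) : cmd := Put a (Cst 0) x.

Definition For (i : nat) (N : expr) (p : cmd) : cmd :=
  Seq (Let i (Cst 0))
      (While (Sub N (Var i)) (Seq p (Let i (Add (Var i) (Cst 1))))).

(** The bound [N] is evaluated afresh before every round, so it may read nothing that the loop
    writes; the invariant must not depend on the counter cell, which the loop itself changes. The
    factor [n.+1] pays for [n] rounds and the last, failing test. *)
Lemma runs_for X Y i N p m (Inv : nat -> memory -> Prop) (Q : memory -> Prop) n :
  ~~ has (mem (i :: written p)) (reads N) -> i \notin written p ->
  eval m N = n ->
  (forall k m' y, Inv k m' -> Inv k (update m' i 0 y)) ->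
  Inv 0 m ->
  (forall k m', k < n -> unchanged (i :: written p) m m' -> m' i 0 = k -> Inv k m' ->
     runs X p m' (Inv k.+1)) ->
  0 < X -> n.+1 * X <= Y ->
  (forall m', unchanged (i :: written p) m m' -> Inv n m' -> Q m') ->
  runs Y (For i N p) m Q.
Proof.
move=> rdN iNp Nn upd Inv0 body X0 XY QQ.
pose c := (expr_time (Sub N (Var i)) + ctime (Seq p (Let i (Add (Var i) (Cst 1))))).+1.
suff loop k j m' : k + j = n -> unchanged (i :: written p) m m' -> m' i 0 = k -> Inv k m' ->
    exists t m'', [/\ exec (While (Sub N (Var i)) (Seq p (Let i (Add (Var i) (Cst 1))))) m' t m'',
       t <= c * (j.+1 * X), unchanged (i :: written p) m m'' & Inv n m''].
  have [||||t [m'' [ex le_t un In]]] := loop 0 n (update m i 0 0).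
  - by [].
  - by apply: update_unchanged; rewrite inE eqxx.
  - by rewrite /update !eqxx.
  - exact: upd.
  exists (3 + t), m''; split; last exact: QQ.
    by apply: ExecSeq ex; apply: ExecPut.
  rewrite /For [ctime _]/= -/(ctime _).
  apply: (@leq_trans ((3 + c) * (n.+1 * X))); last by apply: leq_mul => //; rewrite /c /=; lia.
  by rewrite mulnDl leq_add //; lia.
elim: j k m' => [|j IH] k m' kj un mi Ik.
  have kn : k = n by lia.
  have e0 : eval m' (Sub N (Var i)) = 0.
    by rewrite /= (eval_unchanged un rdN) Nn mi kn subnn.
  exists (expr_time (Sub N (Var i))).+1, m'; split=> //.
  - exact: ExecWhileFalse.
  - by rewrite mul1n /c; nia.
  - by rewrite -kn.
have kn : k < n by lia.
have [t [m1 [ex1 le1 I1]]] := body k m' kn un mi Ik.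
have un1 := exec_unchanged ex1.
have m1i : m1 i 0 = k by rewrite un1.
set m2 := update m1 i 0 k.+1.
have un2 : unchanged (i :: written p) m m2.
  apply: unchanged_trans un _; apply: (@unchanged_trans _ _ m1).
    by apply: unchanged_sub un1 => a; rewrite inE => ->; rewrite orbT.
  by apply: update_unchanged; rewrite inE eqxx.
have [|||t' [m3 [ex3 le3 un3 I3]]] := IH k.+1 m2 _ un2 _ _.
- by lia.
- by rewrite /m2 /update !eqxx.
- exact: upd.
(* Incrementing the counter takes 6 steps; the 3 above is the cost of its initialisation. *)
have ex2 : exec (Seq p (Let i (Add (Var i) (Cst 1)))) m' (t + 6) m2.
  apply: ExecSeq ex1 _.
  have -> : m2 = update m1 i 0 (eval m1 (Add (Var i) (Cst 1))) by rewrite /m2 /= m1i addn1.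
  exact: (ExecPut m1 i (Cst 0) (Add (Var i) (Cst 1))).
exists ((expr_time (Sub N (Var i)) + (t + 6) + t').+1), m3; split=> //.
  apply: ExecWhileTrue ex2 ex3.
  by rewrite /= (eval_unchanged un rdN) Nn mi; lia.
rewrite (mulSn j.+1) mulnDr.
suff : expr_time (Sub N (Var i)) + (t + 6) < c * X by lia.
have -> : c = expr_time (Sub N (Var i)) + ctime p + 7 by rewrite /c /=; lia.
by have := leq_pmulr (expr_time (Sub N (Var i))) X0; rewrite !mulnDl; lia.
Qed.

(** * Reading the input and peeling the tree *)

(* Array names; a scalar variable is cell 0 of its own array.  The arrays from
   [deg] to [bid] are indexed by vertices, those from [wt] to [cap] by bundles. *)
Local Notation inp := 0 (only parsing).
Local Notation out := 1 (only parsing).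
Local Notation deg := 2 (only parsing).
Local Notation nbs := 3 (only parsing).
Local Notation bid := 4 (only parsing).
Local Notation wt := 5 (only parsing).
Local Notation lo := 6 (only parsing).
Local Notation hi := 7 (only parsing).
Local Notation cap := 8 (only parsing).
Local Notation que := 9 (only parsing).
Local Notation qlen := 10 (only parsing).
Local Notation off := 11 (only parsing).
Local Notation tab := 12 (only parsing).
Local Notation pos := 13 (only parsing).
Local Notation siz := 14 (only parsing).
Local Notation cnt := 15 (only parsing).
Local Notation acc := 16 (only parsing).
Local Notation ci := 17 (only parsing).
Local Notation cj := 18 (only parsing).
Local Notation cg := 19 (only parsing).
Local Notation mn := 20 (only parsing).
Local Notation carry := 21 (only parsing).
Local Notation base := 22 (only parsing).
Local Notation ptr := 23 (only parsing).
Local Notation cv := 24 (only parsing).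
Local Notation cp := 25 (only parsing).
Local Notation cb := 26 (only parsing).

Local Notation nE := (Get inp (Cst 0)) (only parsing).
Local Notation lE := (Get inp (Cst 1)) (only parsing).
Local Notation LE := (Add lE lE) (only parsing).
Local Notation "x ;; y" := (Seq x y) (at level 90, right associativity).
Local Notation incr a x := (Let a (Add (Var a) x)) (only parsing).

Definition read_edge : cmd :=
  let u := Get inp (Var pos) in
  let v := Get inp (Add (Var pos) (Cst 1)) in
  Put deg u (Add (Get deg u) (Cst 1)) ;;
  Put nbs u (Add (Get nbs u) v) ;;
  Put deg v (Add (Get deg v) (Cst 1)) ;;
  Put nbs v (Add (Get nbs v) u) ;;
  incr pos (Cst 2).

Definition read_edges : cmd :=
  Let pos (Cst 4) ;; For ci (Get inp (Cst 3)) read_edge.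

(** The reading position is specified by the suffix of the input that starts there, which avoids
    arithmetic on lengths. The header is the first four numbers of the input, the last of them the
    number of edges. *)
Lemma read_edges_ok n (E : seq ('I_n * 'I_n)) hdr rest s m :
  size hdr = 4 -> nth 0 hdr 3 = size E ->
  s = hdr ++ flatten [seq [:: val p.1; val p.2] | p <- E] ++ rest ->
  (forall i, m inp i = nth 0 s i) ->
  (forall i, m deg i = 0) -> (forall i, m nbs i = 0) ->
  runs (size E).+1 read_edges m (fun m' =>
    [/\ drop (m' pos 0) s = rest,
        forall v : 'I_n, m' deg v = \sum_(p <- E) ((p.1 == v) + (p.2 == v))
      & forall v : 'I_n, m' nbs v = \sum_(p <- E) ((p.1 == v) * p.2 + (p.2 == v) * p.1)]).
Proof.
move=> szh h3 sE min mdeg mnbs; apply: runs_seq; apply: runs_loop_free => //=.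
pose Inv k (m' : memory) :=
    [/\ drop (m' pos 0) s = flatten [seq [:: val p.1; val p.2] | p <- drop k E] ++ rest,
        forall v : 'I_n, m' deg v = \sum_(p <- take k E) ((p.1 == v) + (p.2 == v))
      & forall v : 'I_n, m' nbs v = \sum_(p <- take k E) ((p.1 == v) * p.2 + (p.2 == v) * p.1)].
apply: (@runs_for 1 _ _ _ _ _ Inv _ (size E)) => //.
- by rewrite /= /update /= min sE nth_cat szh /= h3.
- rewrite /Inv /update /= take0 drop0; split.
  + by rewrite sE drop_size_cat.
  + by move=> v; rewrite big_nil mdeg.
  + by move=> v; rewrite big_nil mnbs.
- move=> k m' kE un _ [Hpos Hdeg Hnbs].
  have E0 : 'I_n * 'I_n by case: (E) kE.
  have m'in i : m' inp i = nth 0 s i by rewrite un // /update /= min.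
  move: Hpos; rewrite (drop_nth E0) //=.
  case uvE: (nth E0 E k) => [u v] /= Hpos.
  have inu : m' inp (m' pos 0) = u by rewrite m'in -[m' pos 0]addn0 -nth_drop Hpos.
  have inv : m' inp (m' pos 0 + 1) = v by rewrite m'in -nth_drop Hpos.
  apply: runs_loop_free => //=.
  rewrite /Inv /update /= !inu !inv; split.
  + by rewrite addnC -drop_drop Hpos /= drop0.
  + move=> x; rewrite (take_nth E0) // -cats1 big_cat big_seq1 uvE /= -Hdeg.
    rewrite !(inj_eq val_inj) [u == x]eq_sym [v == x]eq_sym.
    by case: (eqVneq x v) => [->|_];
      [case: (eqVneq v u) => [<-|_] | case: (eqVneq x u) => [->|_]]; rewrite /=; lia.
  + move=> x; rewrite (take_nth E0) // -cats1 big_cat big_seq1 uvE /= -Hnbs.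
    rewrite !(inj_eq val_inj) [u == x]eq_sym [v == x]eq_sym.
    by case: (eqVneq x v) => [->|_];
      [case: (eqVneq v u) => [<-|_] | case: (eqVneq x u) => [->|_]]; rewrite /= ?mul1n ?mul0n; lia.
- by rewrite muln1.
- by move=> m' _ []; rewrite drop_size take_size.
Qed.

(** In truncated subtraction [1 - (2 - siz)] is 1 when the size is at least 2 and 0 otherwise: it is
    both the test for a non-singleton bundle and the least cap. *)
Definition read_bundle_header : cmd :=
  Put wt (Var ci) (Get inp (Var pos)) ;;
  Let siz (Get inp (Add (Var pos) (Cst 1))) ;;
  Put lo (Var ci) (Sub (Cst 1) (Sub (Cst 2) (Var siz))) ;;
  If (Get lo (Var ci)) (Put hi (Var ci) LE) (Put hi (Var ci) (Cst 0)) ;;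
  Put cap (Var ci) (Get lo (Var ci)) ;;
  incr pos (Cst 2).

Definition read_bundles : cmd :=
  For ci lE
    (read_bundle_header ;;
     For cj (Var siz) (Put bid (Get inp (Var pos)) (Var ci) ;; incr pos (Cst 1))).

(** Disjointness keeps [bid] of a vertex from being overwritten by a later bundle. A bundle listed
    without repetition has at most [n] vertices, whence the factor [n.+1]. *)
Lemma read_bundles_ok n (Bs : seq (seq 'I_n)) (wf : seq 'I_n -> nat) s m :
  drop (m pos 0) s = flatten [seq wf b :: size b :: map val b | b <- Bs] ->
  (forall i, m inp i = nth 0 s i) -> nth 0 s 1 = size Bs ->
  all uniq Bs ->
  (forall (v : 'I_n) j j', j < size Bs -> j' < size Bs ->
     v \in nth [::] Bs j -> v \in nth [::] Bs j' -> j = j') ->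
  runs ((size Bs).+1 * n.+1) read_bundles m (fun m' =>
    forall j, j < size Bs ->
    [/\ m' wt j = wf (nth [::] Bs j),
        m' lo j = (1 < size (nth [::] Bs j)),
        m' hi j = if 1 < size (nth [::] Bs j) then 2 * size Bs else 0,
        m' cap j = m' lo j
      & forall v : 'I_n, v \in nth [::] Bs j -> m' bid v = j]).
Proof.
move=> spos min s1 uniqBs dis.
pose good k (m' : memory) := forall j, j < k ->
    [/\ m' wt j = wf (nth [::] Bs j),
        m' lo j = (1 < size (nth [::] Bs j)),
        m' hi j = if 1 < size (nth [::] Bs j) then 2 * size Bs else 0,
        m' cap j = m' lo j
      & forall v : 'I_n, v \in nth [::] Bs j -> m' bid v = j].
pose Inv k (m' : memory) :=
  drop (m' pos 0) s = flatten [seq wf b :: size b :: map val b | b <- drop k Bs] /\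
  good k m'.
apply: (@runs_for n.+1 _ _ _ _ _ Inv _ (size Bs)) => //.
- by rewrite /= min s1.
- by split=> //; rewrite spos drop0.
- move=> k m1 kB un mk [Hpos Hgood].
  have m1in i : m1 inp i = nth 0 s i by rewrite un.
  move: Hpos; rewrite (drop_nth [::]) //=.
  set b := nth [::] Bs k => Hpos.
  have inw : m1 inp (m1 pos 0) = wf b by rewrite m1in -[m1 pos 0]addn0 -nth_drop Hpos.
  have ins : m1 inp (m1 pos 0 + 1) = size b by rewrite m1in -nth_drop Hpos.
  have in1 : m1 inp 1 = size Bs by rewrite m1in s1.
  have ub : uniq b by apply: (allP uniqBs); apply: mem_nth.
  apply: runs_seq; apply: runs_loop_free => //.
  cbv beta; set m2 := sem _ _.
  have m2in i : m2 inp i = m1 inp i by rewrite /m2 /= /update /=; case: ifP.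
  have m2k : m2 ci 0 = k by rewrite /m2 /= /update /=; case: ifP.
  have m2s : m2 siz 0 = size b by rewrite /m2 /= /update /= -ins; case: ifP.
  have m2w j : m2 wt j = if j == k then wf b else m1 wt j.
    by rewrite /m2 /= /update /= mk inw; case: ifP.
  have m2bid : m2 bid = m1 bid by rewrite /m2 /= /update /=; case: ifP.
  have m2pos : drop (m2 pos 0) s = [seq \val i | i <- b] ++
      flatten [seq wf b :: size b :: map val b | b <- drop k.+1 Bs].
    have -> : m2 pos 0 = m1 pos 0 + 2 by rewrite /m2 /= /update /=; case: ifP.
    by rewrite addnC -drop_drop Hpos /= drop0.
  have szlo : 1 - (2 - size b) = (1 < size b) by case: (size b) => [|[|?]].
  have m2lo j : m2 lo j = if j == k then (1 < size b) : nat else m1 lo j.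
    by rewrite /m2 /= /update /= mk ins szlo !eqxx; case: ifP.
  have m2hi j : m2 hi j = if j == k then if 1 < size b then 2 * size Bs else 0 else m1 hi j.
    rewrite /m2 /= /update /= mk ins szlo !eqxx in1 mul2n -addnn.
    by case: (1 < size b).
  have m2cap j : m2 cap j = if j == k then m2 lo j else m1 cap j.
    rewrite /m2 /= /update /= !mk ins szlo !eqxx.
    by case: (1 < size b) => /=; rewrite !mk ?eqxx; case: (j == k).
  clearbody m2.
  pose Inv' t (m' : memory) :=
    [/\ drop (m' pos 0) s = [seq \val i | i <- drop t b] ++
          flatten [seq wf b :: size b :: map val b | b <- drop k.+1 Bs],
        forall v : 'I_n, v \in take t b -> m' bid v = k
      & forall j (v : 'I_n), j < k -> v \in nth [::] Bs j -> m' bid v = j].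
  apply: (@runs_for 1 _ _ _ _ _ Inv' _ (size b)) => //.
  + rewrite /Inv' drop0; split=> [//|v|j v jk]; first by rewrite take0.
    rewrite m2bid.
    by case: (Hgood j jk) => _ _ _ _; apply.
  + move=> t m3 tb un3 m3t [Hpos3 Hb Hprev].
    have v0 : 'I_n by case: (b) tb.
    have m3k : m3 ci 0 = k by rewrite un3.
    move: Hpos3; rewrite (drop_nth v0) //=; set u := nth v0 b t => Hpos3.
    have inu : m3 inp (m3 pos 0) = u.
      by rewrite un3 // m2in m1in -[m3 pos 0]addn0 -nth_drop Hpos3.
    apply: runs_loop_free => //; rewrite /Inv' /= /update /= inu m3k; split.
    * by rewrite addnC -drop_drop Hpos3 /= drop0.
    * move=> v; rewrite (take_nth v0) // mem_rcons inE (inj_eq val_inj) -/u.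
      by case: eqP => //= _; apply: Hb.
    * move=> j v jk vj; rewrite (inj_eq val_inj); case: eqP => [vu|_]; last exact: Hprev.
      apply: (dis v) vj => //; first exact: ltn_trans kB.
      by rewrite -/b vu mem_nth.
  + by rewrite muln1 ltnS -[n in _ <= n]card_ord -(card_uniqP ub) max_card.
  + move=> m4 un4 [Hpos4 Hb Hprev]; split; first by rewrite Hpos4 drop_size.
    move=> j; rewrite ltnS leq_eqVlt (un4 wt) // (un4 lo) // (un4 hi) // (un4 cap) //.
    rewrite m2w m2hi m2cap m2lo => /orP[/eqP->|jk].
      by rewrite eqxx; split=> // v; rewrite -/b => vb; apply: Hb; rewrite take_size.
    by rewrite ltn_eqF //; case: (Hgood j jk) => ? ? ? ? _; split=> // v; apply: Hprev.
- by move=> m' _ [_].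
Qed.

(** The product of the numbers of caps, by repeated addition; it is the number of guesses. *)
Definition count_caps : cmd :=
  Let cnt (Cst 1) ;;
  For ci lE
    (Let acc (Cst 0) ;;
     For cj (Sub (Add (Get hi (Var ci)) (Cst 1)) (Get lo (Var ci))) (incr acc (Var cnt)) ;;
     Let cnt (Var acc)).

Lemma count_caps_ok l L m :
  m inp 1 = l -> (forall j, j < l -> (m hi j).+1 - m lo j <= L) ->
  runs (l.+1 * L.+1) count_caps m (fun m' => m' cnt 0 = radix_prod (m lo) (m hi) l).
Proof.
move=> ml hL; apply: runs_seq; apply: runs_loop_free => //; cbv beta; set m0 := sem _ _.
pose Inv k (m' : memory) := m' cnt 0 = radix_prod (m lo) (m hi) k.
apply: (@runs_for L.+1 _ _ _ _ _ Inv _ l) => //; first by rewrite /Inv /radix_prod big_ord0.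
move=> k m1 kl un mk Hk.
apply: runs_seq; apply: runs_loop_free => //; cbv beta; set m2 := sem _ _.
pose Inv' t (m' : memory) := m' acc 0 = t * radix_prod (m lo) (m hi) k.
have mE : (m1 hi = m hi) * (m1 lo = m lo) by rewrite !un.
apply: runs_seq; apply: (@runs_for 1 _ _ _ _ _ Inv' _ ((m hi k).+1 - m lo k)) => //.
- by rewrite /m2 /= /update /= mk !mE addn1.
- move=> t m3 tk un3 m3t H3; apply: runs_loop_free => //.
  by rewrite /Inv' /= /update /= H3 un3 // [m2 cnt 0]Hk mulSn addnC.
- by rewrite muln1 ltnS; apply: hL.
- move=> m3 un3 H3; apply: runs_loop_free => //.
  by rewrite /Inv /= /update /= H3 radix_prodS mulnC.
Qed.

(* [deg x] and [nbs x] are the number and the sum of the remaining neighbours of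
   [x], so that [nbs x] is the parent of [x] once [x] is a leaf. *)
Definition push_leaf (x : expr) : cmd :=
  If (Sub (Get deg x) (Cst 1)) Skip (Put que (Var qlen) x ;; incr qlen (Cst 1)).

Definition peel_step : cmd :=
  Let cv (Get que (Var ci)) ;;
  Let cp (Get nbs (Var cv)) ;;
  Put deg (Var cp) (Sub (Get deg (Var cp)) (Cst 1)) ;;
  Put nbs (Var cp) (Sub (Get nbs (Var cp)) (Var cv)) ;;
  push_leaf (Var cp).

(* Raising the degree of the root by 2 keeps it out of the queue of leaves. *)
Definition peel : cmd :=
  Put deg (Cst 0) (Add (Get deg (Cst 0)) (Cst 2)) ;;
  For ci nE (push_leaf (Var ci)) ;;
  For ci (Sub nE (Cst 1)) peel_step.

(** * The invariant of the leaf elimination *)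

Section Peel.
Variables (n : nat) (e : rel 'I_n) (r : 'I_n) (par : 'I_n -> 'I_n) (dep : 'I_n -> nat).
Hypothesis r0 : val r = 0.
Hypothesis sym_e : symmetric e.
Hypothesis irr_e : irreflexive e.
Hypothesis rt : rooted e r par dep.

Let edge_par v : v != r -> e v (par v) := fun vr => (rt.1 v vr).1.
Let dep_par v : v != r -> dep v = (dep (par v)).+1 := fun vr => (rt.1 v vr).2.

Definition nbrs (S : {set 'I_n}) (v : 'I_n) : {set 'I_n} := [set u in S | e v u].

Definition remaining (k : nat) (vs : seq 'I_n) : {set 'I_n} := [set v | v \notin take k vs].

(** Here [vs] is the queue: its first [k] entries have been removed, the others are exactly the
    leaves waiting. A removed vertex has its [nbs] cell frozen at its parent, and [ps_order], which
    the dynamic programming needs, says that the parent survives the removal. *)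
Record peel_state (k : nat) (vs : seq 'I_n) (dg nb : nat -> nat) : Prop := PeelState {
  ps_size : k <= size vs;
  ps_uniq : uniq vs;
  ps_root : r \notin vs;
  ps_deg : forall v, v \in remaining k vs ->
    dg v = #|nbrs (remaining k vs) v| + 2 * (v == r);
  ps_nbs : forall v, v \in remaining k vs ->
    nb v = \sum_(u in nbrs (remaining k vs) v) u;
  ps_closed : forall v, v \in remaining k vs -> v != r -> par v \in remaining k vs;
  ps_queue : forall v, v \in drop k vs =
    [&& v \in remaining k vs, v != r & #|nbrs (remaining k vs) v| == 1];
  ps_par : forall v, v \in take k vs -> nb v = par v;
  ps_order : forall i, i < k -> par (nth r vs i) \notin take i.+1 vs
}.

(** A neighbour other than the parent would be a child, hence deeper. *)
Lemma nbrs_deepest (S : {set 'I_n}) v :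
  par v \in S -> v != r -> (forall u, u \in S -> u != r -> dep u <= dep v) ->
  nbrs S v = [set par v].
Proof.
move=> pS vr deepest; apply/setP=> u; rewrite !inE.
apply/andP/eqP => [[uS evu]|->]; last by rewrite edge_par.
have [[_ //]|[ur vE]] := rt.2 v u evu.
by have := deepest u uS ur; rewrite (dep_par ur) -vE ltnn.
Qed.

(** The queue does not run dry early: as long as a vertex besides the root remains, a deepest one is
    a leaf and must be waiting. *)
Lemma peel_progress k vs dg nb : peel_state k vs dg nb -> k < n.-1 -> k < size vs.
Proof.
move=> st kn; rewrite ltnNge; apply/negP => szk.
have : drop k vs = [::] by apply: drop_oversize.
set S := remaining k vs.
have rS : r \in S by rewrite inE; apply: contra (ps_root st); apply: mem_take.
have cS : #|S| = n - k.
  have -> : S = ~: [set v in take k vs] by apply/setP => v; rewrite !inE.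
  rewrite cardsCs setCK card_ord cardsE (card_uniqP _) ?take_uniq ?(ps_uniq st) //.
  by rewrite size_take_min (minn_idPl (ps_size st)).
have /card_gt0P[v0] : 0 < #|S :\ r|.
  by move: cS; rewrite (cardsD1 r) rS add1n -ltnS => ->; lia.
rewrite in_setD1 => v0S.
have [v /andP[vr vS] deepest] := @arg_maxnP _ v0 (fun v => (v != r) && (v \in S)) dep v0S.
move=> dropE; have := ps_queue st v; rewrite dropE in_nil -/S vS vr /=.
rewrite (nbrs_deepest (ps_closed st vS vr) vr) ?cards1 // => u uS ur.
by apply: deepest; rewrite ur.
Qed.

Definition set_at (f : nat -> nat) (i x : nat) : nat -> nat :=
  fun j => if j == i then x else f j.

(** Removing the leaf [v] affects only the counts of its parent [p], so [p] is the only candidate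
    for a new leaf. The conditional on [vs] is the test of [push_leaf]. *)
Lemma peel_stateS k vs dg nb (v := nth r vs k) (p := par v)
    (dg' := set_at dg p (dg p - 1)) (nb' := set_at nb p (nb p - v)) :
  peel_state k vs dg nb -> k < n.-1 ->
  nb v = p /\ peel_state k.+1 (if dg' p - 1 != 0 then vs else rcons vs p) dg' nb'.
Proof.
move=> st kn; have kv := peel_progress st kn.
set S := remaining k vs.
have dropE : drop k vs = v :: drop k.+1 vs by rewrite (drop_nth r).
have := ps_queue st v; rewrite dropE mem_head -/S => /esym/and3P[vS vr].
have pS : p \in S := ps_closed st vS vr.
case/cards1P => z Nz.
have Nv : nbrs S v = [set p].
  have : p \in nbrs S v by rewrite !inE edge_par // andbT; move: pS; rewrite inE.
  by rewrite Nz inE => /eqP->.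
have nbv : nb v = p by rewrite (ps_nbs st vS) -/S Nv big_set1.
have pv : p != v by apply/eqP => pv; have := edge_par vr; rewrite -/p pv irr_e.
split=> //.
have takeE : take k.+1 vs = rcons (take k vs) v by rewrite (take_nth r).
have S'E : remaining k.+1 vs = S :\ v.
  by apply/setP => u; rewrite !inE takeE mem_rcons inE negb_or.
have NS u : nbrs (S :\ v) u = nbrs S u :\ v.
  by apply/setP => w; rewrite !inE andbA.
have NSu u : u \in S -> u != p -> nbrs S u :\ v = nbrs S u.
  move=> uS up; apply/setDidPl; rewrite disjoint_sym disjoints1 inE negb_and.
  apply/orP; right; apply/negP => euv.
  have : u \in nbrs S v by rewrite inE uS sym_e.
  by rewrite Nv inE (negPf up).
have vNp : v \in nbrs S p by rewrite inE vS sym_e edge_par.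
have cNp : #|nbrs S p| = (#|nbrs S p :\ v|).+1 by rewrite (cardsD1 v) vNp.
(* Depths exclude this two-cycle of [par], so a nonroot [p] keeps its own parent as a neighbour
   after the removal of [v]. *)
have par_pv : p != r -> par p != v.
  move=> pr; apply/eqP => ppv; have := dep_par vr; have := dep_par pr.
  by rewrite ppv -/p; lia.
have Np0 : p != r -> 0 < #|nbrs S p :\ v|.
  move=> pr; apply/card_gt0P; exists (par p).
  by rewrite !inE par_pv // edge_par // andbT; have := ps_closed st pS pr; rewrite inE.
have degp : dg' p = #|nbrs S p :\ v| + 2 * (p == r).
  by rewrite /dg' /set_at eqxx (ps_deg st pS) -/S cNp addSn subn1.
(* The truncated test also accepts degree 0, but a nonroot [p] still has its parent; the root is
   excluded by its raised degree. *)
have pushE : (dg' p - 1 != 0) = (p == r) || (#|nbrs S p :\ v| != 1).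
  rewrite degp; case: (eqVneq p r) => [_|/Np0] /=; first by rewrite muln1 addn2.
  by rewrite muln0 addn0; case: #|_| => [|[|k0]].
(* Before the removal a nonroot [p] has both [v] and its parent as neighbours, so it was not waiting
   yet and enters the queue only once. *)
have pnd : p \notin drop k vs.
  rewrite (ps_queue st) -/S pS /=; case: (eqVneq p r) => //= pr.
  by have := Np0 pr; rewrite cNp; lia.
have pnt : p \notin take k vs by move: pS; rewrite inE.
have pvs : p \notin vs by rewrite -(cat_take_drop k vs) mem_cat negb_or pnt.
set vs' := if _ then _ else _.
have take' i : i <= size vs -> take i vs' = take i vs.
  by move=> ik; rewrite /vs'; case: ifP => // _; rewrite -cats1 takel_cat.
have rem' : remaining k.+1 vs' = S :\ v by rewrite -S'E /remaining take'.
have drop' : drop k.+1 vs' = if dg' p - 1 != 0 then drop k.+1 vs else rcons (drop k.+1 vs) p.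
  by rewrite /vs'; case: ifP => // _; rewrite drop_rcons.
have nth' i : i < k.+1 -> nth r vs' i = nth r vs i.
  move=> ik; rewrite /vs'; case: ifP => // _; rewrite nth_rcons ifT //.
  exact: leq_trans kv.
split; rewrite ?rem'.
- by rewrite /vs'; case: ifP => // _; rewrite size_rcons; lia.
- by rewrite /vs'; case: ifP => // _; rewrite ?rcons_uniq ?pvs ?(ps_uniq st).
- rewrite /vs'; case: ifP => [_|]; first exact: ps_root st.
  move/negbT; rewrite pushE negb_or => /andP[pr _].
  by rewrite mem_rcons inE negb_or eq_sym pr (ps_root st).
- move=> u; rewrite !inE => /andP[uv uS]; rewrite NS.
  have [->|up] := eqVneq u p; first exact: degp.
  rewrite /dg' /set_at (inj_eq val_inj) (negPf up) NSu ?inE //.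
  by rewrite (ps_deg st) // inE.
- move=> u; rewrite !inE => /andP[uv uS]; rewrite NS.
  rewrite /nb' /set_at (inj_eq val_inj); have [->|up] := eqVneq u p.
    by rewrite (ps_nbs st pS) (big_setD1 v) //= addKn.
  by rewrite NSu ?inE // (ps_nbs st) // inE.
- move=> u; rewrite !inE => /andP[uv uS] ur.
  have uS' : u \in S by rewrite inE.
  have := ps_closed st uS' ur; rewrite inE => ->; rewrite andbT.
  apply/eqP => puv; have up : u = p.
    by apply/set1P; rewrite -Nv inE uS' -puv sym_e edge_par.
  by move: ur; rewrite up => pr; have := par_pv pr; rewrite -puv up eqxx.
- move=> u; rewrite drop' NS.
  have dk : (u \in drop k.+1 vs) = (u != v) && (u \in drop k vs).
    rewrite dropE inE; case: (eqVneq u v) => //= ->.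
    by have := drop_uniq k (ps_uniq st); rewrite dropE /= => /andP[/negbTE].
  have [->|up] := eqVneq u p; last first.
    have -> : (u \in (if dg' p - 1 != 0 then drop k.+1 vs else rcons (drop k.+1 vs) p))
              = (u \in drop k.+1 vs).
      by case: ifP => // _; rewrite mem_rcons inE (negPf up).
    rewrite dk (ps_queue st) -/S in_setD1 -andbA; case: (boolP (u \in S)) => uS; rewrite ?andbF //=.
    by rewrite NSu.
  rewrite in_setD1 pv pS /=.
  have pk1 : (p \in drop k.+1 vs) = false by apply: contraNF pnd; rewrite dropE inE orbC => ->.
  rewrite pushE; case: (eqVneq p r) => //= _; case: (eqVneq #|_| 1) => //= _.
  by rewrite mem_rcons mem_head.
- move=> u; rewrite take' // takeE mem_rcons inE => ut.
  have up : u != p.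
    by apply: contraTneq ut => ->; rewrite negb_or pv pnt.
  rewrite /nb' /set_at (inj_eq val_inj) (negPf up).
  by case/orP: ut => [/eqP->|/(ps_par st)].
- move=> i; rewrite ltnS => ik; rewrite nth' // take'; last exact: leq_ltn_trans kv.
  move: ik; rewrite leq_eqVlt => /orP[/eqP->|/(ps_order st)//].
  by rewrite takeE mem_rcons inE negb_or pv.
Qed.


Lemma peel_state_ext k vs dg nb dg' nb' :
  dg =1 dg' -> nb =1 nb' -> peel_state k vs dg nb -> peel_state k vs dg' nb'.
Proof.
move=> Ed En [? ? ? Hd Hn ? ? Hp ?]; split=> // v.
- by rewrite -Ed; apply: Hd.
- by rewrite -En; apply: Hn.
- by rewrite -En; apply: Hp.
Qed.

Lemma sem_push_leaf x m (vs : seq 'I_n) (y : 'I_n) (m' := sem (push_leaf x) m)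
    (vs' := if m deg y - 1 != 0 then vs else rcons vs y) :
  eval m x = y -> ~~ has (mem [:: que]) (reads x) ->
  m qlen 0 = size vs -> (forall j, j < size vs -> m que j = nth r vs j) ->
  m' qlen 0 = size vs' /\ (forall j, j < size vs' -> m' que j = nth r vs' j).
Proof.
rewrite /m' /vs' /= => -> _ mq mque; case: ifP => // _.
rewrite /update /= mq size_rcons addn1; split=> // j.
rewrite ltnS leq_eqVlt nth_rcons => /orP[/eqP->|jv].
  by rewrite eqxx ltnn.
by rewrite jv ltn_eqF // mque.
Qed.

Lemma peel_ok m :
  m inp 0 = n -> m qlen 0 = 0 ->
  (forall v : 'I_n, m deg v = \sum_(u | e v u) 1) ->
  (forall v : 'I_n, m nbs v = \sum_(u | e v u) u) ->
  runs n.+1 peel m (fun m' => exists vs : seq 'I_n,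
    [/\ size vs = n.-1, uniq vs, r \notin vs &
        forall i, i < n.-1 -> [/\ m' que i = nth r vs i,
          m' nbs (nth r vs i) = par (nth r vs i)
          & par (nth r vs i) \notin take i.+1 vs]]).
Proof.
move=> mn mq mdeg mnbs; apply: runs_seq; apply: runs_loop_free => //; cbv beta.
set m0 := sem _ _.
have m0deg (v : 'I_n) : m0 deg v = #|nbrs setT v| + 2 * (v == r).
  rewrite /m0 /= /update /= -val_eqE /= r0 -sum1_card.
  have -> : \sum_(u in nbrs setT v) 1 = m deg v.
    by rewrite mdeg; apply: eq_bigl => u; rewrite !inE.
  by case: eqP => [->|_]; lia.
have m0nbs (v : 'I_n) : m0 nbs v = \sum_(u in nbrs setT v) u.
  by rewrite /m0 /= /update /= mnbs; apply: eq_bigl => u; rewrite !inE.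
pose queue vs (m' : memory) :=
  m' qlen 0 = size vs /\ (forall j, j < size vs -> m' que j = nth r vs j).
pose Inv0 k m' := exists2 vs : seq 'I_n, queue vs m' &
  uniq vs /\ forall v, v \in vs = (v < k) && (m0 deg v - 1 == 0).
apply: runs_seq; apply: (@runs_for 1 _ _ _ _ _ Inv0 _ n) => //.
- by exists [::].
- move=> k m1 kn un mk [vs [qs qq] [uvs inv]]; apply: runs_loop_free => //.
  pose x := Ordinal kn.
  have [qs' qq'] := @sem_push_leaf (Var ci) m1 vs x mk isT qs qq.
  exists (if m1 deg x - 1 != 0 then vs else rcons vs x) => //.
  rewrite un //.
  have xvs : x \notin vs by rewrite inv /= ltnn.
  split; first by case: ifP => // _; rewrite rcons_uniq xvs.
  move=> v; rewrite ltnS leq_eqVlt -[nat_of_ord v == k]/(val v == val x).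
  rewrite (inj_eq val_inj); case: (eqVneq v x) => [->|vx] /=.
    by case: eqP => /= E; [rewrite mem_rcons mem_head | rewrite (negbTE xvs)].
  by rewrite -inv; case: ifP => // _; rewrite mem_rcons inE (negPf vx).
- by rewrite muln1.
move=> m1 un1 [vs [qs qq] [uvs inv]].
have rem0 : remaining 0 vs = setT by apply/setP => v; rewrite !inE take0.
have deg0 v : v != r -> 0 < #|nbrs setT v|.
  by move=> vr; apply/card_gt0P; exists (par v); rewrite !inE edge_par.
have st0 : peel_state 0 vs (m1 deg) (m1 nbs).
  split=> //; rewrite ?rem0 ?drop0 ?take0 //.
  - by rewrite inv m0deg eqxx muln1 addn2 subn1 andbF.
  - by move=> v _; rewrite un1 // m0deg.
  - by move=> v _; rewrite un1 // m0nbs.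
  - by move=> v _ _; rewrite inE.
  - move=> v; rewrite inv ltn_ord m0deg inE /=.
    case: (eqVneq v r) => [_|/deg0] /=; first by rewrite muln1 addn2.
    by rewrite muln0 addn0; case: #|_| => [|[|?]].
pose Inv k (m' : memory) := exists2 vs : seq 'I_n, queue vs m' & peel_state k vs (m' deg) (m' nbs).
apply: (@runs_for 1 _ _ _ _ _ Inv _ n.-1) => //.
- by rewrite /= !un1 // [m0 _ _]mn subn1.
- by exists vs.
- move=> k m2 kn un2 m2k [vs2 [qs2 qq2] st2]; apply: runs_loop_free => //.
  have kv := peel_progress st2 kn.
  set v := nth r vs2 k; set p := par v.
  have [nbv st3] := peel_stateS st2 kn; rewrite -/v -/p in nbv st3.
  have quek : m2 que k = v by apply: qq2.
  set pre := (Let cv (Get que (Var ci)) ;; Let cp (Get nbs (Var cv)) ;;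
    Put deg (Var cp) (Sub (Get deg (Var cp)) (Cst 1)) ;;
    Put nbs (Var cp) (Sub (Get nbs (Var cp)) (Var cv))).
  have -> : sem peel_step m2 = sem (push_leaf (Var cp)) (sem pre m2) by [].
  set m3 := sem pre m2.
  have m3deg : m3 deg =1 set_at (m2 deg) p (m2 deg p - 1).
    by move=> j; rewrite /m3 /= /update /= m2k quek nbv.
  have m3nbs : m3 nbs =1 set_at (m2 nbs) p (m2 nbs p - v).
    by move=> j; rewrite /m3 /= /update /= m2k quek nbv.
  have m3p : eval m3 (Var cp) = p by rewrite /m3 /= /update /= m2k quek nbv.
  have m3q : m3 que = m2 que by [].
  have m3l : m3 qlen = m2 qlen by [].
  clearbody m3.
  have := @sem_push_leaf (Var cp) m3 vs2 p m3p isT; rewrite m3q m3l => /(_ qs2 qq2) qn.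
  exists (if m3 deg p - 1 != 0 then vs2 else rcons vs2 p); first exact: qn.
  rewrite m3deg; apply: peel_state_ext st3 => j.
    by rewrite -m3deg /= ; case: ifP.
  by rewrite -m3nbs /=; case: ifP.
- by rewrite muln1; lia.
move=> m2 un2 [vs2 [qs2 qq2] st2]; exists (take n.-1 vs2).
have szt : size (take n.-1 vs2) = n.-1 by rewrite size_takel // (ps_size st2).
split=> //; first by rewrite take_uniq // (ps_uniq st2).
  by apply: contra (ps_root st2); apply: mem_take.
move=> i ik; rewrite nth_take // take_takel //; split.
- by rewrite qq2 // (leq_trans ik (ps_size st2)).
- by apply: (ps_par st2); rewrite -(nth_take r ik) mem_nth ?szt.
- exact: ps_order st2 _ ik.
Qed.

End Peel.

(** * Evaluating all guesses *)

(* Row [v] of the table [tab] starts at [off v].  There is no multiplication, so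
   the penalty of each colour is obtained from that of the previous one. *)
Definition fill_cell : cmd :=
  If (Sub (Add (Var cj) (Cst 1)) (Get cap (Get bid (Var ci))))
     (incr acc (Get wt (Get bid (Var ci)))) Skip ;;
  Put tab (Var ptr) (Var acc) ;;
  incr ptr (Cst 1).

Definition fill : cmd :=
  Let ptr (Cst 0) ;;
  For ci nE
    ((Put off (Var ci) (Var ptr) ;; Let acc (Cst 0)) ;;
     For cj LE fill_cell).

(** The sum of the two opposite truncated differences is the absolute difference, so the outer test
    says that the colours differ. *)
Definition relax : cmd :=
  If (Add (Sub (Var cb) (Var cj)) (Sub (Var cj) (Var cb)))
     (If (Sub (Var mn) (Get tab (Add (Get off (Var cv)) (Var cb))))
         (Let mn (Get tab (Add (Get off (Var cv)) (Var cb)))) Skip)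
     Skip.

(* [1 - cj] is a colour other than [cj]. *)
Definition combine_color : cmd :=
  Let mn (Get tab (Add (Get off (Var cv)) (Sub (Cst 1) (Var cj)))) ;;
  For cb LE relax ;;
  (let cell := Add (Get off (Var cp)) (Var cj) in
   Put tab cell (Add (Get tab cell) (Var mn))).

Definition combine : cmd :=
  For ci (Sub nE (Cst 1))
    ((Let cv (Get que (Var ci)) ;; Let cp (Get nbs (Var cv))) ;;
     For cj LE combine_color).

Definition sum_caps : cmd :=
  Let base (Cst 0) ;;
  For ci lE (For cj (Get cap (Var ci)) (incr base (Get wt (Var ci)))).

(* The first candidate of all is taken unconditionally. *)
Definition take_best : cmd :=
  let cand := Add (Var base) (Get tab (Add (Get off (Cst 0)) (Var cj))) in
  If (Add (Sub (Cst 1) (Add (Var cg) (Var cj))) (Sub (Var out) cand)) (Let out cand) Skip.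

Definition odometer_digit : cmd :=
  If (Var carry)
     (If (Sub (Get hi (Var ci)) (Get cap (Var ci)))
         (Put cap (Var ci) (Add (Get cap (Var ci)) (Cst 1)) ;; Let carry (Cst 0))
         (Put cap (Var ci) (Get lo (Var ci))))
     Skip.

Definition odometer : cmd := Let carry (Cst 1) ;; For ci lE odometer_digit.

Lemma pair_index_lt n L (u v : 'I_n) a b : a < L -> u < v -> u * L + a < v * L + b.
Proof. by move=> aL uv; have := leq_mul uv (leqnn L); lia. Qed.

(** Row-major addressing of [tab]: a write to one entry disturbs no other. *)
Lemma pair_index_inj n L (u v : 'I_n) a b : a < L -> b < L ->
  (u * L + a == v * L + b) = (u == v) && (a == b).
Proof.
move=> aL bL; case: (ltngtP u v) => uv.
- rewrite ltn_eqF ?(pair_index_lt b aL uv) //.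
  by apply/esym/negbTE; rewrite negb_and -val_eqE /= ltn_eqF.
- rewrite gtn_eqF ?(pair_index_lt a bL uv) //.
  by apply/esym/negbTE; rewrite negb_and -val_eqE /= gtn_eqF.
- by rewrite (val_inj uv) eqn_add2l eqxx.
Qed.

Section Guess.
Variables (n l L : nat) (w : nat -> nat) (bi : 'I_n -> nat).

Lemma fill_ok m :
  m inp 0 = n -> m inp 1 + m inp 1 = L ->
  (forall v : 'I_n, m bid v = bi v) -> (forall v, m wt (bi v) = w (bi v)) ->
  runs (n.+1 * L.+1) fill m (fun m' =>
    (forall v : 'I_n, m' off v = v * L) /\
    (forall (v : 'I_n) a, a < L -> m' tab (v * L + a) = penalty w bi (m cap) v a)).
Proof.
move=> mn mL mbid mwt; apply: runs_seq; apply: runs_loop_free => //; cbv beta.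
set m0 := sem _ _.
pose good x (m' : memory) := forall (v : 'I_n) a, a < L -> v * L + a < x ->
  m' tab (v * L + a) = penalty w bi (m cap) v a.
pose Inv k (m' : memory) := [/\ m' ptr 0 = k * L,
  forall v : 'I_n, v < k -> m' off v = v * L & good (k * L) m'].
apply: (@runs_for L.+1 _ _ _ _ _ Inv _ n) => //.
- move=> k m1 kn un mk [m1p m1o m1g].
  apply: runs_seq; apply: runs_loop_free => //; cbv beta; set m2 := sem _ _.
  pose x := Ordinal kn.
  have m2E : (m2 bid = m bid) * (m2 cap = m cap) * (m2 wt = m wt).
    by rewrite -[m bid](un bid) // -[m cap](un cap) // -[m wt](un wt).
  (* [acc] is the penalty of colour [t - 1], and 0 at the start of a row. It grows by the weight
     exactly when [t.+1] exceeds the cap. *)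
  pose Inv' t (m' : memory) := [/\ m' ptr 0 = k * L + t,
     m' acc 0 = w (bi x) * (t - m cap (bi x)) & good (k * L + t) m'].
  apply: (@runs_for 1 _ _ _ _ _ Inv' _ L) => //.
  + by rewrite /= /m2 /= /update /= un.
  + by rewrite /Inv' addn0 sub0n muln0; split.
  + move=> t m3 tL un3 m3t [m3p m3a m3g]; apply: runs_loop_free => //.
    have m3k : m3 ci 0 = k by rewrite un3.
    have m3b : m3 bid k = bi x by rewrite un3 // m2E -mbid.
    have m3c : m3 cap = m cap by rewrite un3 // m2E.
    have m3w : m3 wt (bi x) = w (bi x) by rewrite un3 // m2E mwt.
    have accE : sem (If (Sub (Add (Var cj) (Cst 1)) (Get cap (Get bid (Var ci))))
        (incr acc (Get wt (Get bid (Var ci)))) Skip) m3 acc 0 = w (bi x) * (t.+1 - m cap (bi x)).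
      rewrite /= m3k m3b m3c m3t; case: eqP => /= h.
        by rewrite m3a; congr (_ * _); lia.
      by rewrite /update /= m3a m3w -mulnSr; congr (_ * _); lia.
    rewrite /fill_cell; set cs := If _ _ _ in accE *.
    have [cst csp] : (sem cs m3 tab = m3 tab) /\ (sem cs m3 ptr = m3 ptr).
      by rewrite /= /update; split; case: ifP.
    change (Inv' t.+1 (sem (Put tab (Var ptr) (Var acc) ;; incr ptr (Cst 1)) (sem cs m3))).
    move: accE cst csp; move: (sem cs m3) => m4 m4a m4t m4p.
    have p4 : m4 ptr 0 = k * L + t by rewrite m4p.
    rewrite /Inv' /= /update /= p4 m4a; split=> [|//|v a aL]; first by rewrite addn1 addnS.
    rewrite /= m4t -[k]/(val x) (pair_index_inj v x aL tL) addnS ltnS leq_eqVlt.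
    rewrite (pair_index_inj v x aL tL); case: (v =P x) => [->|_] /=; last exact: m3g.
    by case: (a =P t) => [->|_] //=; exact: (m3g x a aL).
  + by rewrite muln1.
  + move=> m3 un3 [m3p m3a m3g]; rewrite /Inv mulSn [L + _]addnC; split=> //.
    move=> v vk; rewrite un3 // /m2 /= /update /= mk m1p.
    move: vk; rewrite ltnS leq_eqVlt; case: eqP => [->//|_ /=]; exact: m1o.
- move=> m' _ [_ m'o m'g]; split=> [v|v a aL]; first exact: m'o.
  by apply: m'g => //; have := leq_mul (ltn_ord v) (leqnn L); lia.
Qed.

Lemma sum_caps_ok m :
  m inp 1 = l -> (forall j, j < l -> m cap j <= L) -> (forall j, j < l -> m wt j = w j) ->
  runs (l.+1 * L.+1) sum_caps m (fun m' => m' base 0 = \sum_(j < l) w j * m cap j).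
Proof.
move=> ml mL mw; apply: runs_seq; apply: runs_loop_free => //; cbv beta; set m0 := sem _ _.
pose Inv k (m' : memory) := m' base 0 = \sum_(j < k) w j * m cap j.
apply: (@runs_for L.+1 _ _ _ _ _ Inv _ l) => //.
- by rewrite /Inv big_ord0.
- move=> k m1 kl un mk Hk.
  pose Inv' t (m' : memory) := m' base 0 = \sum_(j < k) w j * m cap j + w k * t.
  apply: (@runs_for 1 _ _ _ _ _ Inv' _ (m cap k)) => //.
  + by rewrite /= mk un.
  + by rewrite /Inv' muln0 addn0.
  + move=> t m2 tk un2 m2t H2; apply: runs_loop_free => //.
    rewrite /Inv' /= /update /= H2 (un2 ci) // mk (un2 wt) // (un wt) // [m0 wt k]mw //.
    by rewrite mulnS [w k + _]addnC addnA.
  + by rewrite muln1 ltnS; apply: mL.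
  + by move=> m2 _; rewrite /Inv /Inv' big_ord_recr.
Qed.

(** When [cg] is positive, [out] holds the best value of earlier guesses and competes with the new
    candidates. In the first round it holds no candidate yet. The root is vertex 0, so its row
    starts at cell 0 of [tab]. *)
Lemma take_best_ok m :
  0 < L -> m inp 1 + m inp 1 = L -> m off 0 = 0 ->
  runs L.+1 (For cj LE take_best) m (fun m' =>
    [/\ (exists2 a, a < L & m' out 0 = m base 0 + m tab a) \/
        (0 < m cg 0 /\ m' out 0 = m out 0),
        forall a, a < L -> m' out 0 <= m base 0 + m tab a
      & 0 < m cg 0 -> m' out 0 <= m out 0]).
Proof.
move=> L0 mL mo.
(* [0 < t + m cg 0] says that some candidate has been seen, in this round or an earlier one. *)
pose Inv t (m' : memory) :=
  [/\ 0 < t + m cg 0 -> (exists2 a, a < t & m' out 0 = m base 0 + m tab a) \/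
        (0 < m cg 0 /\ m' out 0 = m out 0),
        forall a, a < t -> m' out 0 <= m base 0 + m tab a
      & 0 < m cg 0 -> m' out 0 <= m out 0].
apply: (@runs_for 1 _ _ _ _ _ Inv _ L) => //.
- by split=> // ?; right.
- move=> t m1 tL un mt [H1 H2 H3]; apply: runs_loop_free => //.
  rewrite /= !(un base, un tab, un off, un cg) // mo mt add0n.
  case: eqP => /= h; last first.
    rewrite /Inv /update /=; split.
    + by move=> _; left; exists t.
    + by move=> a; rewrite ltnS leq_eqVlt => /orP[/eqP->//|at_]; have := H2 a at_; lia.
    + by move=> g0; have := H3 g0; lia.
  split=> //.
  + move=> _; have /H1[[a at_ E]|E] : 0 < t + m cg 0 by lia.
      by left; exists a => //; apply: ltnW.
    by right.
  + by move=> a; rewrite ltnS leq_eqVlt => /orP[/eqP->|/H2//]; lia.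
- by rewrite muln1.
- move=> m' _ [H1 H2 H3]; split=> //; apply: H1; lia.
Qed.

(** The boolean [b] is the carry out of the last digit: it is set only when the last guess wraps
    around to the first. *)
Lemma odometer_ok m :
  m inp 1 = l -> in_box (m lo) (m hi) l (m cap) ->
  runs l.+1 odometer m (fun m' =>
    in_box (m lo) (m hi) l (m' cap) /\ exists b : bool,
    rank (m lo) (m hi) l (m' cap) + b * radix_prod (m lo) (m hi) l =
      (rank (m lo) (m hi) l (m cap)).+1).
Proof.
move=> ml box; apply: runs_seq; apply: runs_loop_free => //; cbv beta; set m0 := sem _ _.
pose Inv k (m' : memory) := exists b : bool,
  [/\ m' carry 0 = b, in_box (m lo) (m hi) l (m' cap),
      forall j, k <= j -> m' cap j = m cap j
    & rank (m lo) (m hi) k (m' cap) + b * radix_prod (m lo) (m hi) k =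
      (rank (m lo) (m hi) k (m cap)).+1].
apply: (@runs_for 1 _ _ _ _ _ Inv _ l) => //.
- by exists true; split=> //; rewrite /rank /radix_prod !big_ord0.
- move=> k m1 kl un mk [b [m1b m1box m1c m1r]]; apply: runs_loop_free => //.
  have ck : m1 cap k = m cap k by apply: m1c.
  have /andP[lo_le le_hi] := box k kl.
  rewrite /= m1b; case: b m1b m1r => /= m1b m1r; last first.
    exists false; split=> // [j kj|]; first by apply: m1c; apply: ltnW.
    by rewrite !rankS ck; move: m1r; lia.
  have m0E : (m0 hi = m hi) * (m0 lo = m lo) by [].
  rewrite !(un hi, un lo) // !m0E mk ck; case: eqP => /= h.
    set m2 := update _ _ _ _; have c2 j : m2 cap j = if j == k then m lo k else m1 cap j by [].
    have r2 : rank (m lo) (m hi) k (m2 cap) = rank (m lo) (m hi) k (m1 cap).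
      by apply: eq_rank => j jk; rewrite c2 ltn_eqF.
    exists true; split; first by [].
    + by move=> j jl; rewrite c2; case: eqP => [->|_]; [rewrite leqnn (leq_trans lo_le) | apply: m1box].
    + by move=> j kj; rewrite c2 gtn_eqF //; apply: m1c; apply: ltnW.
    rewrite !rankS radix_prodS r2 c2 eqxx subnn.
    have -> : (m hi k).+1 - m lo k = (m cap k - m lo k).+1 by lia.
    by move: m1r => /=; nia.
  set m2 := update _ _ _ _; have c2 j : m2 cap j = if j == k then m cap k + 1 else m1 cap j by [].
  have r2 : rank (m lo) (m hi) k (m2 cap) = rank (m lo) (m hi) k (m1 cap).
    by apply: eq_rank => j jk; rewrite c2 ltn_eqF.
  exists false; split; first by [].
  + by move=> j jl; rewrite c2; case: eqP => [->|_]; [lia | apply: m1box].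
  + by move=> j kj; rewrite c2 gtn_eqF //; apply: m1c; apply: ltnW.
  rewrite !rankS r2 c2 eqxx.
  have -> : m cap k + 1 - m lo k = (m cap k - m lo k).+1 by lia.
  by move: m1r => /=; rewrite mulSn; lia.
- by rewrite muln1.
- by move=> m' _ [b [_ ? _ ?]]; split=> //; exists b.
Qed.

End Guess.

Lemma combine_color_ok n (L t : nat) (v p : 'I_n) m :
  1 < L -> t < L -> p != v ->
  m inp 1 + m inp 1 = L -> (forall u : 'I_n, m off u = u * L) ->
  m cv 0 = v -> m cp 0 = p -> m cj 0 = t ->
  runs L.+1 combine_color m (fun m' => exists2 x,
    is_min_of (fun k => exists b, [/\ b < L, b != t & k = m tab (v * L + b)]) x &
    forall i, m' tab i = if i == p * L + t then m tab i + x else m tab i).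
Proof.
move=> L2 tL pv mL moff mv mp mt.
apply: runs_seq; apply: runs_loop_free => //; cbv beta; set m0 := sem _ _.
have m0mn : m0 mn 0 = m tab (v * L + (1 - t)) by rewrite /m0 /= /update /= mv mt moff.
pose Inv s (m' : memory) :=
  (exists b, [/\ b < L, b != t & m' mn 0 = m tab (v * L + b)]) /\
  forall b, b < s -> b != t -> m' mn 0 <= m tab (v * L + b).
apply: runs_seq; apply: (@runs_for 1 _ _ _ _ _ Inv _ L) => //.
(* [1 - t] is 1 for [t = 0] and 0 otherwise; it is a legal colour because [1 < L], so the minimum
   starts from an attained value. *)
- by split=> //; exists (1 - t); split=> //; case: (t) => [|[|?]] //; lia.
- move=> s m1 sL un ms [[b [bL bt mb]] H]; apply: runs_loop_free => //.
  have mE : (m1 tab = m tab) * (m1 off = m off) * (m1 cv = m cv) * (m1 cj = m cj).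
    by rewrite !un.
  rewrite /= !mE ms mt mv moff.
  have st : (s - t + (t - s) != 0) = (s != t) by lia.
  rewrite st; case: eqP => /= [sE|/eqP nst].
    split; first by exists b.
    by move=> c; rewrite ltnS leq_eqVlt => /orP[/eqP->|cs ct]; [rewrite sE eqxx | exact: H].
  case: eqP => /= h.
    split; first by exists b.
    by move=> c; rewrite ltnS leq_eqVlt => /orP[/eqP-> _|cs ct]; [lia | exact: H].
  split; first by exists s.
  move=> c; rewrite ltnS leq_eqVlt /update /= => /orP[/eqP->//|cs ct].
  by have := H c cs ct; lia.
- by rewrite muln1.
move=> m1 un [ex H]; apply: runs_loop_free => //.
exists (m1 mn 0); first by split=> // _ [b [bL bt ->]]; apply: H.
move=> i; rewrite /= /update /=.
have m0E : (m0 cp = m cp) * (m0 cj = m cj) * (m0 off = m off) * (m0 tab = m tab) by [].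
by rewrite !(un tab, un off, un cp, un cj) // !m0E mp mt moff; case: eqP => [->|].
Qed.

Lemma combine_ok n (L : nat) (r : 'I_n) (par : 'I_n -> 'I_n) vs pen m :
  1 < L -> m inp 0 = n -> m inp 1 + m inp 1 = L -> (forall u : 'I_n, m off u = u * L) ->
  size vs = n.-1 -> uniq vs -> r \notin vs ->
  (forall i, i < n.-1 -> [/\ m que i = nth r vs i,
          m nbs (nth r vs i) = par (nth r vs i)
          & par (nth r vs i) \notin take i.+1 vs]) ->
  (forall (v : 'I_n) a, a < L -> m tab (v * L + a) = pen v a) ->
  runs (n * (L.+1 * L.+1)) combine m (fun m' =>
    forall a, a < L ->
    is_min_of (fun k => exists c, [/\ forall v, c v < L, c r = a,
                          forall v, v != r -> c v != c (par v)
                        & k = \sum_v pen v (c v)]) (m' tab (r * L + a))).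
Proof.
move=> L2 mn' mL moff szvs uvs rvs order mtab.
have n0 : n = n.-1.+1 by rewrite prednK // (leq_trans _ (ltn_ord r)).
pose Inv k (m' : memory) :=
  dp_table par L pen (remaining k vs) (fun v a => m' tab (v * L + a)).
apply: (@runs_for (L.+1 * L.+1) _ _ _ _ _ Inv _ n.-1) => //.
- by rewrite /= mn' subn1.
- rewrite /Inv (_ : remaining 0 vs = setT); first exact: dp_table_init.
  by apply/setP => v; rewrite !inE take0.
- move=> k m1 kn un mk dp1.
  have [quek nbk nord] := order k kn.
  set v := nth r vs k in quek nbk nord; set p := par v in nbk nord.
  have takeE : take k.+1 vs = rcons (take k vs) v by rewrite (take_nth r) ?szvs.
  have /andP[pv pk] : (p != v) && (p \notin take k vs).
    by move: nord; rewrite takeE mem_rcons inE negb_or.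
  have vk : v \notin take k vs.
    by have := take_uniq k.+1 uvs; rewrite takeE rcons_uniq => /andP[].
  apply: runs_seq; apply: runs_loop_free => //; cbv beta; set m2 := sem _ _.
  have m2v : m2 cv 0 = v by rewrite /m2 /= /update /= mk un.
  have m2p : m2 cp 0 = p by rewrite /m2 /= /update /= mk !(un que, un nbs) // quek nbk.
  have m2E : (m2 tab = m1 tab) * (m2 off = m off) * (m2 inp = m inp).
    by rewrite -[m off](un off) // -[m inp](un inp).
  clearbody m2.
  pose f u a := m1 tab (u * L + a).
  (* Row [p] is updated in place and its first [t] entries are new. Row [v] keeps its old entries
     because [p] differs from [v], so all minima refer to the old table. *)
  pose Inv' t (m' : memory) :=
    (forall a, a < t -> exists2 x,
       is_min_of (fun k => exists b, [/\ b < L, b != a & k = f v b]) x &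
       m' tab (p * L + a) = f p a + x) /\
    (forall (u : 'I_n) a, a < L -> (u != p) || (t <= a) -> m' tab (u * L + a) = f u a).
  apply: (@runs_for L.+1 _ _ _ _ _ Inv' _ L) => //.
  + by rewrite /= !m2E.
  + by split=> // u a _ _; rewrite m2E.
  + move=> t m3 tL un3 m3t [H1 H2].
    have m3E : (m3 off = m off) * (m3 inp = m inp) * (m3 cv = m2 cv) * (m3 cp = m2 cp).
      by rewrite !un3 // !m2E.
    apply: runs_weaken (@combine_color_ok n L t v p m3 _ _ _ _ _ _ _ _) _ _;
      rewrite ?m3E //.
    move=> m4 _ [x xmin m4E]; split.
    * move=> a; rewrite ltnS leq_eqVlt => /orP[/eqP->|at_].
        exists x; last by rewrite m4E eqxx H2 ?leqnn ?orbT.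
        case: xmin => [[b [bL bt ->]] lb]; split.
          by exists b; rewrite H2 // eq_sym pv.
        move=> _ [c [cL ct ->]]; apply: lb; exists c.
        by rewrite H2 // eq_sym pv.
      have [y ymin yE] := H1 a at_; exists y => //.
      by rewrite m4E pair_index_inj ?(ltn_trans at_) // eqxx /= ltn_eqF.
    * move=> u a aL ua; rewrite m4E pair_index_inj //.
      have -> : (u == p) && (a == t) = false.
        by move: ua; case: (u == p) => //=; case: eqP => // ->; rewrite ltnn.
      by apply: H2 => //; case/orP: ua => [->//|/ltnW->]; rewrite orbT.
  + move=> m3 un3 [H1 H2].
    have remE : remaining k.+1 vs = remaining k vs :\ v.
      by apply/setP => u; rewrite !inE takeE mem_rcons inE negb_or.
    rewrite /Inv remE.
    (* The minima are not stored; each is recovered as the increase of the parent's entry. *)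
    pose mnv a := m3 tab (p * L + a) - f p a.
    apply: (@dp_table_step _ par L pen (remaining k vs) f _ v mnv); rewrite ?inE //.
    * move=> a aL; have [x xmin xE] := H1 a aL.
      by rewrite /mnv xE addKn.
    * by move=> a aL; have [x xmin xE] := H1 a aL; rewrite /mnv xE addKn.
    * by move=> u a _ up aL; apply: H2; rewrite // up.
- by rewrite -n0.
move=> m' un dp a aL; apply: (@dp_table_root _ par L pen r (fun v a => m' tab (v * L + a)) a _ aL).
suff <- : remaining n.-1 vs = [set r] by [].
have cr : #|remaining n.-1 vs| = 1.
  have -> : remaining n.-1 vs = ~: [set v in take n.-1 vs] by apply/setP => v; rewrite !inE.
  rewrite cardsCs setCK card_ord cardsE (card_uniqP _) ?take_uniq //.
  by rewrite size_takel ?szvs // n0 /= subSnn.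
have rr : r \in remaining n.-1 vs by rewrite inE; apply: contra rvs; apply: mem_take.
by apply/esym/eqP; rewrite eqEcard sub1set rr cr cards1.
Qed.

(** * The search over all guesses *)

Definition guess : cmd :=
  fill ;; combine ;; sum_caps ;; For cj LE take_best ;; odometer.

Definition search : cmd := For cg (Var cnt) guess.

(** The truncated difference of [C + 1] and the minimum is nonzero exactly when the minimum is at
    most [C]. *)
Definition solver : cmd :=
  read_edges ;; read_bundles ;; count_caps ;; peel ;; search ;;
  Put out (Cst 1) (Sub (Add (Get inp (Cst 2)) (Cst 1)) (Var out)).

Lemma eq_objective n l w (bi : 'I_n -> nat) x y c :
  (forall v, bi v < l) -> (forall j, j < l -> x j = y j) ->
  objective l w bi x c = objective l w bi y c.
Proof.
move=> bil E; rewrite /objective; congr (_ + _).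
  by apply: eq_bigr => j _; rewrite E.
by apply: eq_bigr => v _; rewrite /penalty E.
Qed.

Definition proper_below n (L : nat) (r : 'I_n) (par : 'I_n -> 'I_n) (c : 'I_n -> nat) : Prop :=
  (forall v, c v < L) /\ (forall v, v != r -> c v != c (par v)).

Lemma search_ok n l L w (bi : 'I_n -> nat) (r : 'I_n) (par : 'I_n -> 'I_n) vs m :
  1 < L -> l <= L -> (forall v, bi v < l) -> val r = 0 ->
  m inp 0 = n -> m inp 1 = l -> l + l = L ->
  (forall v : 'I_n, m bid v = bi v) -> (forall j, j < l -> m wt j = w j) ->
  size vs = n.-1 -> uniq vs -> r \notin vs ->
  (forall i, i < n.-1 -> [/\ m que i = nth r vs i,
          m nbs (nth r vs i) = par (nth r vs i)
          & par (nth r vs i) \notin take i.+1 vs]) ->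
  (forall j, j < l -> m lo j <= m hi j <= L) ->
  (forall j, j < l -> m cap j = m lo j) ->
  m cnt 0 = radix_prod (m lo) (m hi) l ->
  runs ((m cnt 0).+1 * (n.+1 * (L.+1 * L.+1))) search m (fun m' =>
    is_min_of (fun k => exists x c,
      [/\ in_box (m lo) (m hi) l x, proper_below L r par c & k = objective l w bi x c])
     (m' out 0)).
Proof.
move=> L2 lL bil r0 m0n m0l llL mbid mwt szvs uvs rvs order lohi capE cntE.
set N := m cnt 0; set B := n.+1 * (L.+1 * L.+1).
have box0 : in_box (m lo) (m hi) l (m cap).
  by move=> j jl; rewrite capE // leqnn; have /andP[] := lohi j jl.
have rank0 : rank (m lo) (m hi) l (m cap) = 0.
  by rewrite /rank big1 // => j _; rewrite capE // subnn.
have N0 : 0 < N by rewrite /N cntE; have := rank_lt box0; lia.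
pose P k (g : nat) := exists x c, [/\ in_box (m lo) (m hi) l x, rank (m lo) (m hi) l x < g,
      proper_below L r par c & k = objective l w bi x c].
(* [out] is the minimum over the guesses of rank below [g], and the current guess has rank [g].
   After the last round the odometer has wrapped around, hence the premise [g < N]; before the first
   there is no candidate, hence [0 < g]. *)
pose Inv g (m' : memory) := [/\ in_box (m lo) (m hi) l (m' cap),
    g < N -> rank (m lo) (m hi) l (m' cap) = g,
    0 < g -> P (m' out 0) g & forall k, P k g -> m' out 0 <= k].
apply: (@runs_for B _ _ _ _ _ Inv _ N) => //.
- by split=> // k [x [c []]].
- move=> g m1 gN un mg [box1 rank1 best1 low1].
  have m1E : (m1 inp = m inp) * (m1 bid = m bid) * (m1 wt = m wt) * (m1 lo = m lo) *
      (m1 hi = m hi) * (m1 que = m que) * (m1 nbs = m nbs) by rewrite !un.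
  have m1L : m1 inp 1 + m1 inp 1 = L by rewrite m1E m0l.
  have cap1 j : j < l -> m1 cap j <= L.
    by move=> jl; have := box1 j jl; have := lohi j jl; lia.
  apply: runs_seq; apply: (runs_weaken (@fill_ok n L w bi m1 _ _ _ _)); rewrite ?m1E ?m0l //.
    by move=> v; rewrite mwt.
    by rewrite /B; nia.
  move=> m2 un2 [m2off m2tab].
  apply: runs_seq.
  apply: (runs_weaken (@combine_ok n L r par vs (penalty w bi (m1 cap)) m2 _ _ _ _ _ _ _ _ _)).
    1-9: rewrite ?(un2 inp, un2 que, un2 nbs) // ?m1E ?m0l //.
    by rewrite /B; nia.
  move=> m3 un3 m3tab.
  apply: runs_seq; apply: (runs_weaken (@sum_caps_ok l L w m3 _ _ _)).
    1-3: rewrite ?(un3 inp, un3 cap, un3 wt) // ?(un2 inp, un2 cap, un2 wt) // ?m1E //.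
    by rewrite /B; nia.
  move=> m4 un4; rewrite (un3 cap) // (un2 cap) // => m4base.
  apply: runs_seq; apply: (runs_weaken (@take_best_ok L m4 _ _ _)).
    by apply: ltnW.
    by rewrite (un4 inp) // (un3 inp) // (un2 inp) // m1E m0l.
    by rewrite (un4 off) // (un3 off) //; have := m2off r; rewrite -[nat_of_ord r]/(val r) r0.
    by rewrite /B; nia.
  move=> m5 un5 []; rewrite (un4 tab) // (un4 cg) // (un3 cg) // (un2 cg) // mg.
  rewrite (un4 out) // (un3 out) // (un2 out) // => H1 H2 H3.
  have m3root a : m3 tab a = m3 tab (r * L + a) by rewrite -[nat_of_ord r]/(val r) r0.
  have m5E : (m5 lo = m lo) * (m5 hi = m hi) * (m5 cap = m1 cap) * (m5 inp = m inp).
    rewrite !(un5 lo, un5 hi, un5 cap, un5 inp) // !(un4 lo, un4 hi, un4 cap, un4 inp) //.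
    rewrite !(un3 lo, un3 hi, un3 cap, un3 inp) // !(un2 lo, un2 hi, un2 cap, un2 inp) //.
    by rewrite !m1E.
  have lb c : proper_below L r par c -> m5 out 0 <= objective l w bi (m1 cap) c.
    move=> [cL cp]; apply: leq_trans (H2 (c r) (cL r)) _.
    rewrite m4base leq_add2l m3root; apply: (m3tab (c r) (cL r)).2.
    by exists c.
  apply: (runs_weaken (@odometer_ok l m5 _ _)); rewrite ?m5E //.
    by rewrite /B; nia.
  move=> m6 un6 [box6 [b rank6]]; rewrite rank1 // in rank6.
  rewrite /Inv (un6 out) //; split=> //.
  + move=> g1; case: b rank6; rewrite ?mul0n ?addn0 //.
    by rewrite mul1n -cntE -/N; lia.
  + move=> _; case: H1 => [[a aL ->]|[/best1[x [c [bx rx pc E]]] ->]]; last first.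
      by exists x, c; split=> //; apply: ltnW.
    have [[c [cL cr cp E]] _] := m3tab a aL; exists (m1 cap), c; split=> //.
      by rewrite rank1.
    by rewrite m4base m3root E.
  + move=> k [x [c [bx rx pc ->]]]; move: rx; rewrite ltnS leq_eqVlt => /orP[/eqP rx|rx].
      (* A guess of rank exactly [g] coincides with the current caps on all bundles. *)
      rewrite (@eq_objective _ _ _ _ _ (m1 cap)) //; first exact: lb.
      by apply: rank_inj bx box1 _; rewrite rx rank1.
    apply: leq_trans (H3 _) _; first by lia.
    by apply: low1; exists x, c.
- move=> m' un [_ _ best low]; split.
    have [x [c [bx _ pc E]]] := best N0.
    by exists x, c.
  move=> _ [x [c [bx pc ->]]]; apply: low; exists x, c; split=> //.
  by rewrite /N cntE; apply: rank_lt.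
Qed.

(** * The instance behind the input word *)

(** An edge is listed in exactly one orientation, so the two terms together meet every neighbour of
    [v] once. With [g] constant 1 this gives degrees, with [g] the vertex number the neighbour
    sums. *)
Lemma sum_edges n (e : rel 'I_n) (E : seq ('I_n * 'I_n)) (v : 'I_n) (g : 'I_n -> nat) :
  lists_edges e E ->
  \sum_(p <- E) ((p.1 == v) * g p.2 + (p.2 == v) * g p.1) = \sum_(u | e v u) g u.
Proof.
move=> [uE aE eE].
transitivity (\sum_(x : 'I_n) \sum_(y : 'I_n)
    if (x, y) \in E then (x == v) * g y + (y == v) * g x else 0).
  rewrite big_uniq //= big_mkcond pair_bigA /=.
  by apply: eq_bigr => -[x y] _.
transitivity (\sum_x \sum_y (if (x, y) \in E then (x == v) * g y else 0) +
              \sum_x \sum_y (if (x, y) \in E then (y == v) * g x else 0)).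
  rewrite -big_split /=; apply: eq_bigr => x _; rewrite -big_split /=.
  by apply: eq_bigr => y _; case: ifP.
rewrite (bigD1 v) //= [X in _ + X + _]big1 => [|x xv]; last first.
  by apply: big1 => y _; rewrite (negPf xv); case: ifP.
rewrite [X in _ + X]exchange_big /= [X in _ + X](bigD1 v) //=.
rewrite [X in _ + (_ + X)]big1 => [|x xv]; last first.
  by apply: big1 => y _; rewrite (negPf xv); case: ifP.
rewrite !addn0 -big_split [RHS]big_mkcond /=; apply: eq_bigr => u _.
rewrite eE !eqxx !mul1n; case: (boolP ((v, u) \in E)) => [/aE/negPf->|_] /=; first by rewrite addn0.
by rewrite add0n.
Qed.

Section Bundles.
Variables (n : nat) (B : {set {set 'I_n}}) (Bs : seq (seq 'I_n)).
Hypothesis BBs : lists_bundles B Bs.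
Hypothesis partB : partition B [set: 'I_n].

Let l := size Bs.
Let block j : {set 'I_n} := [set x in nth [::] Bs j].

(** For a partition the first bundle containing [v] is the only one, so this is the number that
    reading leaves in [bid]. *)
Definition bundle_of (v : 'I_n) : nat := find (fun b : seq 'I_n => v \in b) Bs.

Lemma big_bundles (R : Type) (idx : R) (op : Monoid.com_law idx) (F : {set 'I_n} -> R) :
  \big[op/idx]_(b in B) F b = \big[op/idx]_(j < l) F (block j).
Proof.
by rewrite -big_enum -(perm_big _ BBs.2) big_map (big_nth [::]) big_mkord.
Qed.

Lemma size_bundles : l = #|B|.
Proof. by rewrite cardE -(perm_size BBs.2) size_map. Qed.

Lemma block_in j : j < l -> block j \in B.
Proof.
move=> jl; rewrite -mem_enum -(perm_mem BBs.2); apply/mapP.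
by exists (nth [::] Bs j) => //; apply: mem_nth.
Qed.

Lemma bundle_uniq (v : 'I_n) j j' : j < l -> j' < l ->
  v \in nth [::] Bs j -> v \in nth [::] Bs j' -> j = j'.
Proof.
move=> jl jl' vj vj'; case/and3P: partB => _ /trivIsetP triv _.
have us : uniq [seq [set x in b] | b <- Bs] by rewrite (perm_uniq BBs.2) enum_uniq.
have blE i : i < l -> nth set0 [seq [set x in b] | b <- Bs] i = block i.
  by move=> il; rewrite (nth_map [::]).
apply/eqP; rewrite -(nth_uniq set0 _ _ us) ?size_map // !blE //.
apply/negPn/negP => neq.
have /pred0P/(_ v) := triv _ _ (block_in jl) (block_in jl') neq.
by rewrite /= !inE vj vj'.
Qed.

Lemma bundle_ofP v : bundle_of v < l /\ v \in nth [::] Bs (bundle_of v).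
Proof.
suff h : has (fun b : seq 'I_n => v \in b) Bs.
  by split; [rewrite -has_find | apply: (nth_find [::] h)].
have : v \in cover B by rewrite (cover_partition partB) inE.
case/bigcupP => b; rewrite -mem_enum -(perm_mem BBs.2) => /mapP[b' b'B ->].
by rewrite inE => vb'; apply/hasP; exists b'.
Qed.

Lemma bundle_of_eq v j : j < l -> (bundle_of v == j) = (v \in nth [::] Bs j).
Proof.
move=> jl; have [bl vb] := bundle_ofP v.
by apply/eqP/idP => [<-//|vj]; apply: bundle_uniq vb vj.
Qed.

Lemma card_block j : j < l -> #|block j| = bundle_size bundle_of j.
Proof. by move=> jl; apply: eq_card => v; rewrite !inE bundle_of_eq. Qed.

Lemma size_block j : j < l -> size (nth [::] Bs j) = bundle_size bundle_of j.
Proof.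
move=> jl; rewrite -card_block // cardsE; apply/esym/card_uniqP.
by apply: (allP BBs.1); apply: mem_nth.
Qed.

Lemma bundle_size_gt0 j : j < l -> 0 < bundle_size bundle_of j.
Proof.
move=> jl; rewrite -card_block // card_gt0.
by apply: contraTneq (block_in jl) => ->; case/and3P: partB.
Qed.

Lemma sum_bundle_max (wt : {set 'I_n} -> nat) (c : 'I_n -> nat) :
  \sum_(b in B) wt b * \max_(v in b) c v =
  bundle_cost l (fun j => wt (block j)) bundle_of c.
Proof.
rewrite big_bundles; apply: eq_bigr => j _; congr (_ * _).
by apply: eq_bigl => v; rewrite inE bundle_of_eq.
Qed.

(** This is the source of the factor [(2l) ^ t]: [L] caps for a non-singleton bundle, one for a
    singleton. *)
Lemma radix_prod_bundles L lo hi :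
  (forall j, j < l -> lo j = cap_lo bundle_of j /\ hi j = cap_hi L bundle_of j) ->
  radix_prod lo hi l = L ^ #|[set b in B | 2 <= #|b| ]|.
Proof.
move=> E; transitivity (\prod_(b in B) (if 2 <= #|b| then L else 1)).
  rewrite big_bundles; apply: eq_bigr => j _; have [-> ->] := E j (ltn_ord j).
  by rewrite card_block // /cap_lo /cap_hi; case: ifP => _; rewrite ?subn1 ?subn0.
by rewrite -big_mkcondr prod_nat_const -cardsE.
Qed.

End Bundles.

(** Any proper colouring is first brought below [2l] by [few_colors] and then matched by caps
    through [objective_attained], so [k] is a lower bound. Conversely [objective_ge] bounds the cost
    of the optimal colouring by [k], and the two bounds meet. *)
Lemma is_min_cost_objective (I : instance) (Bs : seq (seq 'I_(num_vertices I)))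
    (r : 'I_(num_vertices I)) par dep lo hi k :
  cover (bundles I) = [set: 'I_(num_vertices I)] ->
  symmetric (edge I) -> rooted (edge I) r par dep ->
  partition (bundles I) [set: 'I_(num_vertices I)] -> lists_bundles (bundles I) Bs ->
  (forall j, j < size Bs -> lo j = cap_lo (bundle_of Bs) j /\
                            hi j = cap_hi (2 * size Bs) (bundle_of Bs) j) ->
  is_min_of (fun k => exists x c,
      [/\ in_box lo hi (size Bs) x, proper_below (2 * size Bs) r par c
        & k = objective (size Bs) (fun j => weight I [set x in nth [::] Bs j])
              (bundle_of Bs) x c]) k ->
  is_min_cost I k.
Proof.
move=> cov sym rt partB BBs lohi [[x [c [bx [cL cp] kE]]] low].
set w := fun j => _ in kE low.
have costE c' : cost I c' = bundle_cost (size Bs) w (bundle_of Bs) c'.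
  exact: (sum_bundle_max BBs partB).
have bl v : bundle_of Bs v < size Bs by have [] := bundle_ofP BBs partB v.
have low' c' : proper_coloring I c' -> k <= cost I c'.
  move=> pc'.
  have [c2 [[c2pos c2p] c2L c2c]] := few_colors cov (rooted_parity rt) pc'.
  apply: leq_trans c2c.
  (* The tables number colours from 0; no colour is lost, since proper colours are positive. *)
  pose c0 v := (c2 v).-1.
  have c0E v : (c0 v).+1 = c2 v by rewrite prednK.
  have c0L v : c0 v < 2 * size Bs by rewrite c0E (size_bundles BBs) c2L.
  have [y [by_ yE]] := objective_attained w bl (bundle_size_gt0 BBs partB) c0L.
  have -> : cost I c2 = objective (size Bs) w (bundle_of Bs) y c0.
    by rewrite yE costE; apply: eq_bigr => j _; congr (_ * _); apply: eq_bigr => v _; rewrite c0E.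
  apply: low; exists y, c0; split=> //.
    by move=> j jl; have [-> ->] := lohi j jl; apply: by_.
  split=> // v vr; apply/eqP => E; apply: (c2p v (par v)); first exact: (rt.1 v vr).1.
  by rewrite -!c0E E.
have pc : proper_coloring I (fun v => (c v).+1).
  split=> // u v euv [E]; have [[ur vE]|[vr uE]] := rt.2 u v euv.
    by have := cp u ur; rewrite -vE E eqxx.
  by have := cp v vr; rewrite -uE E eqxx.
split=> //; exists (fun v => (c v).+1); split=> //.
apply/eqP; rewrite eqn_leq low' // andbT kE costE.
exact: objective_ge.
Qed.

(** * Correctness and running time of the whole program *)

Lemma solver_ok (I : instance) (s : seq nat) :
  valid_instance I -> is_tree (edge I) ->
  partition (bundles I) [set: 'I_(num_vertices I)] -> encodes I s ->
  let L := 2 * num_bundles I in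
  runs ((L ^ num_nonsingleton I).+1 * ((num_vertices I).+1 * (L.+1 * L.+1)))
    solver (initial_memory s) (fun m =>
      is_min_cost I (m output_array 0) /\
      m output_array 1 = (budget I).+1 - m output_array 0).
Proof.
move=> [_ _ cov _ _] tree partB [E [Bs [listE BBs sE]]] L.
have [[sym irr] Vpos _ _] := tree.
set n := num_vertices I in E Bs listE BBs sE *.
set l := size Bs.
have lE : l = num_bundles I by apply: size_bundles BBs.
have LE' : L = 2 * l by rewrite lE.
have n0 : 0 < n by rewrite -[n]card_ord.
pose r : 'I_n := Ordinal n0.
have [par [dep rt]] := tree_rooted r tree.
pose w j := weight I [set x in nth [::] Bs j].
pose bi := bundle_of Bs.
have bl v : bi v < l by have [] := bundle_ofP BBs partB v.
have l0 : 0 < l by apply: leq_ltn_trans (bl r).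
(* A tree has at most [n] edges, so reading them fits the time bound. *)
have szE : size E <= n.
  rewrite -[X in _ <= X]card_ord; case: listE => uE aE eE.
  by apply: (tree_edges rt uE aE) => u v uv; rewrite eE uv.
set N := L ^ num_nonsingleton I.
have N0 : 0 < N by rewrite expn_gt0 LE'; lia.
set X := N.+1 * _.
(* All preprocessing fits in the bound for a single guess, so the factor [N.+1] is simply given
   away. *)
have leX a : a <= n.+1 * (L.+1 * L.+1) -> a <= X.
  by move=> h; apply: leq_trans h _; rewrite leq_pmull.
set m0 := initial_memory s.
have m0in i : m0 inp i = nth 0 s i by [].
have s1 : nth 0 s 1 = l by rewrite sE.
have s0 : nth 0 s 0 = n by rewrite sE.
have s2 : nth 0 s 2 = budget I by rewrite sE.
set rest := flatten [seq weight I [set x in b] :: size b :: map val b | b <- Bs] in sE.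
apply: runs_seq; apply: (runs_weaken
  (@read_edges_ok n E [:: n; size Bs; budget I; size E] rest s m0 _ _ _ _ _ _)) => //.
  by apply: leX; nia.
move=> m1 un1 [pos1 deg1 nbs1].
have in1 i : m1 inp i = nth 0 s i by rewrite un1.
apply: runs_seq; apply: (runs_weaken
  (@read_bundles_ok n Bs (fun b => weight I [set x in b]) s m1 pos1 in1 s1 BBs.1
     (bundle_uniq BBs partB))).
  by apply: leX; rewrite -/l; nia.
move=> m2 un2 B2.
have in2 i : m2 inp i = nth 0 s i by rewrite un2.
have lohi j : j < l -> m2 lo j = cap_lo bi j /\ m2 hi j = cap_hi L bi j.
  move=> jl; have [_ -> -> _ _] := B2 j jl.
  by rewrite /cap_lo /cap_hi (size_block BBs partB) // LE'.
apply: runs_seq; apply: (runs_weaken (@count_caps_ok l L m2 _ _)).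
- by rewrite in2.
- by move=> j jl; have [-> ->] := lohi j jl; rewrite /cap_lo /cap_hi; case: ifP => _; lia.
- by apply: leX; nia.
move=> m3 un3; rewrite (radix_prod_bundles BBs partB lohi) -/N => cnt3.
apply: runs_seq; apply: (runs_weaken (@peel_ok n (edge I) r par dep _ sym irr rt m3 _ _ _ _)) => //.
- by rewrite un3 // in2.
- by rewrite un3 // un2 // un1.
- move=> v; rewrite un3 // un2 // deg1 -(sum_edges v (fun _ => 1) listE).
  by apply: eq_bigr => p _; rewrite !muln1.
- by move=> v; rewrite un3 // un2 // nbs1 (sum_edges v _ listE).
- by apply: leX; nia.
move=> m4 un4 [vs [szvs uvs rvs order]].
have m4E a : a \in [:: inp; bid; wt; lo; hi; cap] -> m4 a = m2 a.
  by rewrite !inE => /orP[|/orP[|/orP[|/orP[|/orP[|]]]]] /eqP->; rewrite un4 // un3.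
have cnt4 : m4 cnt 0 = N by rewrite un4.
have radE : radix_prod (m4 lo) (m4 hi) l = N.
  by rewrite !m4E //; exact: (radix_prod_bundles BBs partB lohi).
apply: runs_seq.
apply: (runs_weaken (@search_ok n l L w bi r par vs m4 _ _ _ _ _ _ _ _ _ _ _ _ _ _ _ _)) => //.
- by lia.
- by lia.
- by rewrite m4E // in2.
- by rewrite m4E // in2.
- by lia.
- by move=> v; rewrite m4E //; have [vl vb] := bundle_ofP BBs partB v; have [_ _ _ _ ->] := B2 _ vl.
- by move=> j jl; rewrite m4E //; have [-> _ _ _ _] := B2 j jl.
- move=> j jl; rewrite !m4E //; have [-> ->] := lohi j jl.
  by rewrite /cap_lo /cap_hi; case: ifP => _; lia.
- by move=> j jl; rewrite !m4E //; have [_ _ _ -> _] := B2 j jl.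
- by rewrite cnt4 radE.
- by rewrite cnt4.
move=> m5 un5 best; apply: runs_loop_free => //; split; last first.
  by rewrite /= /update /= un5 // m4E // in2 s2 addn1.
rewrite /= /update /=.
rewrite LE' in best.
apply: (is_min_cost_objective cov sym rt partB BBs _ best) => j jl.
by rewrite !m4E //; have [-> ->] := lohi j jl; rewrite LE'.
Qed.

Theorem theorem7 :
  exists (p : cmd) (K : nat),
  forall I : instance,
    valid_instance I ->
    is_tree (edge I) ->
    partition (bundles I) [set: 'I_(num_vertices I)] ->
    solves_within p I
      (K * ((2 * num_bundles I) ^ num_nonsingleton I
            * num_vertices I * num_bundles I ^ 2)).
Proof.
(* With [N], [n] and [l] positive, [N + 1 <= 2N], [n + 1 <= 2n] and [2l + 1 <= 3l], whence the
   constant [2 * 2 * 3 * 3 = 36]. *)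
exists solver, (ctime solver * 36) => I valid tree partB s enc.
have [k [m [ex le_k [minm outm]]]] := solver_ok valid tree partB enc.
exists k, m; split=> //.
- apply: leq_trans le_k _; rewrite -mulnA leq_mul2l; apply/orP; right.
  have n0 : 0 < num_vertices I by have [_ + _ _] := tree; rewrite card_ord.
  (* An empty family would cover no vertex, but the tree has one. *)
  have l0 : 0 < num_bundles I.
    rewrite lt0n; apply/eqP => /cards0_eq B0.
    have := cover_partition partB; rewrite B0 /cover big_set0 => /setP/(_ (Ordinal n0)).
    by rewrite !inE.
  have N0 : 0 < (2 * num_bundles I) ^ num_nonsingleton I by rewrite expn_gt0; lia.
  move: ((2 * num_bundles I) ^ _) N0 => N N0.
  move: (num_vertices I) (num_bundles I) n0 l0 => n l n0 l0.
  apply: (@leq_trans ((2 * N) * ((2 * n) * ((3 * l) * (3 * l))))); last by nia.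
  by do 3 ?apply: leq_mul; lia.
- have [[c [pc cE]] low] := minm; rewrite outm subn_eq0 -ltnNge ltnS; split=> [le_b|[c' [pc' le_b]]].
    by exists c; rewrite cE.
  by apply: leq_trans le_b; apply: low.
Qed.
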